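(* Let $X_n\sim ID(b_n,0,\nu_n)$, $n\ge1$, be a sequence of nondegenerate random variables converging in law towards a nondegenerate $X_\infty\sim ID(b_\infty,0,\nu_\infty)$, with $\mathbb{E}|X_n|^2<+\infty$ for all $n\ge1$ and $\mathbb{E}|X_\infty|^2<+\infty$. Let $\varphi_\infty$ be the characteristic function of $X_\infty$ and suppose there are $C_\infty>0$, $p_\infty\ge1$ such that for all $t\in\mathbb{R}$ $$|\varphi_\infty(t)|\int_0^{|t|}\frac{ds}{|\varphi_\infty(s)|}\le C_\infty|t|^{p_\infty}.$$ Let the law of $X_\infty$ be absolutely continuous with respect to the Lebesgue measure with a bounded density. Then there is a constant $C'_\infty>0$, depending only on the law of $X_\infty$ and on $C_\infty,p_\infty$, such that for all $n\ge1$ $$d_K(X_n,X_\infty)\le C'_\infty\,\Delta_n^{\frac{1}{p_\infty+3}},\qquad \Delta_n=|\eta_n-\eta_\infty|+|\mathbb{E}X_n-\mathbb{E}X_\infty|+\mathbb{E}|Y_n-Y_\infty|,$$ where $\eta_n=\int_{-\infty}^{+\infty}u^2\,\nu_n(du)$, $\eta_\infty=\int_{-\infty}^{+\infty}u^2\,\nu_\infty(du)$, and $Y_n$, $Y_\infty$ are the extended zero-bias random variables associated with $X_n$ and $X_\infty$ (defined in the context).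
   Context: A Lévy measure is a positive Borel measure $\nu$ on $\mathbb{R}$ with $\nu(\{0\})=0$ and $\int(1\wedge u^2)\nu(du)<\infty$. $X\sim ID(b,0,\nu)$ means $\mathbb{E}e^{itX}=\exp\big(itb+\int(e^{itu}-1-itu\mathbf{1}_{|u|\le1})\nu(du)\big)$ for all $t\in\mathbb{R}$. For nondegenerate $X\sim ID(b,0,\nu)$ with finite variance, the extended zero-bias random variable $Y$ associated with $X$ is independent of $X$ and has law $\mu_Y(du)=\frac{\eta(u)}{\int v^2\nu(dv)}du$, where $\eta(v)=\int_v^{+\infty}u\,\nu(du)$ for $v>0$ and $\eta(v)=\int_{-\infty}^v(-u)\,\nu(du)$ for $v<0$. Any coupling of $Y_n$ with $Y_\infty$ may be used in the definition of $\Delta_n$. $d_K(X,Y)=\sup_{x\in\mathbb{R}}|\mathbb{P}(X\le x)-\mathbb{P}(Y\le x)|$. *)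

(* Defs.v *)
From HB Require Import structures.
From mathcomp Require Import all_boot all_order all_algebra.
From mathcomp Require Import complex.
From mathcomp Require Import all_classical all_reals all_analysis.

Set Implicit Arguments.
Unset Strict Implicit.
Unset Printing Implicit Defensive.

Import Order.TTheory GRing.Theory Num.Theory.
Import numFieldNormedType.Exports.

Local Open Scope classical_set_scope.
Local Open Scope ring_scope.

(* The real-valued modulus of a complex number; the norm `|z| of R[i] is
   itself an element of R[i]. *)
Definition cmod (R : realType) (z : R[i]) : R := Normc.normc z.

Definition cexp (R : realType) (z : R[i]) : R[i] :=
  Complex (expR (complex.Re z) * cos (complex.Im z)) (expR (complex.Re z) * sin (complex.Im z)).

Definition cintegral (d : measure_display) (T : measurableType d)
    (R : realType) (mu : {measure set T -> \bar R}) (f : T -> R[i]) : R[i] :=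
  Complex (\int[mu]_x complex.Re (f x)) (\int[mu]_x complex.Im (f x)).

(* t |-> \int e^{itx} mu(dx), the characteristic function of any random
   variable of law mu. *)
Definition charfun (R : realType) (mu : probability R R) (t : R) : R[i] :=
  cintegral mu (fun x => cexp (Complex 0 (t * x))).

Definition levy_measure (R : realType) (nu : {measure set R -> \bar R}) : Prop :=
  (nu [set 0%R] = 0 /\ \int[nu]_u (Num.min 1 (u ^+ 2))%R%:E < +oo)%E.

Definition levy_exponent (R : realType) (b : R) (nu : {measure set R -> \bar R})
    (t : R) : R[i] :=
  Complex 0 (t * b)
  + cintegral nu (fun u => cexp (Complex 0 (t * u)) - 1
                           - Complex 0 (t * u * \1_[set v | `|v| <= 1] u)).

(* mu = ID(b, 0, nu) *)
Definition is_ID (R : realType) (mu : probability R R) (b : R)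
    (nu : {measure set R -> \bar R}) : Prop :=
  levy_measure nu /\ forall t : R, charfun mu t = cexp (levy_exponent b nu t).

Definition nondegenerate_law (R : realType) (mu : probability R R) : Prop :=
  forall c : R, mu [set c] <> 1%E.

Definition bounded_density (R : realType) (mu : probability R R) : Prop :=
  exists f : R -> R,
    [/\ measurable_fun [set: R] f,
        forall x, 0 <= f x,
        exists M : R, forall x, f x <= M
      & forall A : set R, measurable A ->
          mu A = (\int[lebesgue_measure]_(x in A) (f x)%:E)%E].

Definition charfun_growth (R : realType) (mu : probability R R) (C p : R) : Prop :=
  forall t : R,
    ((cmod (charfun mu t))%:E *
       \int[lebesgue_measure]_(s in `[0%R, `|t|%R]) ((cmod (charfun mu s))^-1)%:E
     <= (C * `|t| `^ p)%:E)%E.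

Definition has_law (d : measure_display) (T : measurableType d) (R : realType)
    (P : probability T R) (X : {RV P >-> R}) (mu : probability R R) : Prop :=
  forall A : set R, measurable A -> distribution P X A = mu A.

Definition independent_RVs (d : measure_display) (T : measurableType d)
    (R : realType) (P : probability T R) (X Y : {RV P >-> R}) : Prop :=
  forall A B : set R, measurable A -> measurable B ->
    P (X @^-1` A `&` Y @^-1` B) = (P (X @^-1` A) * P (Y @^-1` B))%E.

Definition cvg_in_law (R : realType) (d : nat -> measure_display)
    (T : forall n, measurableType (d n)) (P : forall n, probability (T n) R)
    (X : forall n, {RV (P n) >-> R})
    (doo : measure_display) (Too : measurableType doo)
    (Poo : probability Too R) (Xoo : {RV Poo >-> R}) : Prop :=
  forall f : R -> R, continuous f -> (exists M : R, forall x, `|f x| <= M) ->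
    ('E_(P n)[f \o X n])%E @[n --> \oo] --> ('E_Poo[f \o Xoo])%E.

(* \int u^2 nu(du), which is the variance of ID(b, 0, nu). *)
Definition levy_second_moment (R : realType)
    (nu : {measure set R -> \bar R}) : \bar R :=
  (\int[nu]_u (u ^+ 2)%:E)%E.

(* The value at v = 0 and the inclusion of the endpoint v only matter on a
   countable, hence Lebesgue-null, set. *)
Definition levy_tail (R : realType) (nu : {measure set R -> \bar R})
    (v : R) : \bar R :=
  (if (0 < v)%R then \int[nu]_(u in `[v, +oo[) u%:E
   else if (v < 0)%R then \int[nu]_(u in `]-oo, v]) (- u)%:E
   else 0)%E.

(* Y is an extended zero-bias random variable associated with
   X ~ ID(b, 0, nu). *)
Definition extended_zero_bias (d : measure_display) (T : measurableType d)
    (R : realType) (P : probability T R) (X : {RV P >-> R})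
    (nu : {measure set R -> \bar R}) (Y : {RV P >-> R}) : Prop :=
  independent_RVs X Y /\
  forall A : set R, measurable A ->
    (distribution P Y A =
     \int[lebesgue_measure]_(u in A) (levy_tail nu u / levy_second_moment nu))%E.

Definition coupling (R : realType) (mu mu' : probability R R)
    (gam : probability (R * R)%type R) : Prop :=
  forall A : set R, measurable A ->
    gam (A `*` setT) = mu A /\ gam (setT `*` A) = mu' A.

Definition d_K (R : realType)
    (d : measure_display) (T : measurableType d) (P : probability T R)
    (d' : measure_display) (T' : measurableType d') (P' : probability T' R)
    (X : {RV P >-> R}) (X' : {RV P' >-> R}) : \bar R :=
  ereal_sup (range (fun x : R => `|cdf X x - cdf X' x|%E)).

(* gam is a coupling of the zero-bias variables Y and Y', so that the last term
   is E|Y - Y'|; it may be +oo, as nu and nu' need not have third moments. *)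
Definition Delta (R : realType)
    (d : measure_display) (T : measurableType d) (P : probability T R)
    (d' : measure_display) (T' : measurableType d') (P' : probability T' R)
    (X : {RV P >-> R}) (X' : {RV P' >-> R})
    (nu nu' : {measure set R -> \bar R})
    (gam : probability (R * R)%type R) : \bar R :=
  (`|levy_second_moment nu - levy_second_moment nu'|
   + `|'E_P[X] - 'E_P'[X']|
   + 'E_gam[fun z => `|z.1 - z.2|%R])%E.

(* Main.v *)
(* Since p_oo >= 1 and d_K <= 1, it suffices to bound d_K by C' Delta^(1/4)
   when Delta <= 1.

   Writing m for the mean of X, the zero-bias law turns the Levy exponent into
   psi(t) = i t m - eta \int_0^t s E e^{isY} ds.  As exp is 1-Lipschitz on the
   left half-plane, this gives, with D := Delta,
   |phi_n(t) - phi_oo(t)| <= C D (t + t^2 + t^3) for t > 0.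

   The passage to distribution functions is a smoothing by the Cauchy kernel
   K(z) = 1 / (1 + z^2): the test functions u |-> atan ((u - x) / h) satisfy
   - atan y = \int_0^oo e^{-t} sin(t y) / t dt, so that their expectations
     differ by O(D / h^3) when h <= 1;
   - \int K(z) F(x + h z) dz = pi / 2 - E atan ((X - x) / h) for the
     distribution function F of X, so that, X_oo having a bounded density,
     d_K is at most this difference plus O(h).
   The choice h = D^(1/4) concludes. *)

(* The difference of the characteristic functions is controlled at every frequency, but only by a
   cubic polynomial, without decay. The kernel K is chosen for its transform e^{-t}, which
   integrates this polynomial over the whole half-line with no cutoff in frequency. The factor 1 / t
   of the arctangent formula does no harm, since the polynomial vanishes at 0. Replacing t by t / h
   multiplies t + t^2 + t^3 by at most h^{-3} when h <= 1, which is the origin of D / h^3. The price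
   is the heavy tail of K: far from the point where the distribution functions differ most, their
   difference is only known to be bounded by its supremum. A window with enough of the mass of K
   leaves a small fraction of that supremum, to be absorbed. Constants may contain the second moment
   of the limiting Lévy measure, but not that of nu_n. Differences of products are therefore split
   so that a transform of Y_n, bounded by 1, multiplies eta_n - eta_oo, and eta_oo multiplies the
   difference of the transforms. *)
Require Import Defs.
From HB Require Import structures.
From mathcomp Require Import all_boot all_order all_algebra.
From mathcomp Require Import all_classical all_reals all_analysis.
From mathcomp Require Import measurable_realfun.
From mathcomp Require complex.
From mathcomp Require Import ring lra.

Set Implicit Arguments.
Unset Strict Implicit.
Unset Printing Implicit Defensive.

Import Order.TTheory GRing.Theory Num.Theory.
Import numFieldNormedType.Exports.

Local Open Scope classical_set_scope.
Local Open Scope ring_scope.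

(** * Lipschitz and quadratic bounds for exp, cos and sin *)

Section trigonometric_bounds.
Context {R : realType}.
Implicit Types x y : R.

(** The derivative is bounded only between the endpoints, in either order. This serves exp on the
    left half-line, and the quadratic bounds, where [k] is the absolute value of [x]. *)
Lemma derive_bound_lipschitz (f df : R -> R) (a b k : R) :
  (forall c : R, is_derive c (1 : R) f (df c)) ->
  (forall c, Num.min a b <= c <= Num.max a b -> `|df c| <= k) ->
  `|f b - f a| <= k * `|b - a|.
Proof.
move=> fdf; wlog: a b / a < b => [H dfk|ab dfk].
  have [ab|ba|->] := ltgtP a b; first exact: H.
    rewrite distrC (distrC b); apply: H => // c.
    by rewrite minC maxC; exact: dfk.
  by rewrite !subrr normr0 mulr0.
have [|c cab ->] := MVT ab (fun x _ => fdf x).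
  apply: continuous_subspaceT => x.
  by apply: differentiable_continuous; exact/derivable1_diffP/ex_derive.
rewrite normrM ler_wpM2r// dfk//.
move: cab; rewrite in_itv/= => /andP[ac cb].
by rewrite (min_idPl (ltW ab)) (max_idPr (ltW ab)) !ltW.
Qed.

Lemma cos_lipschitz x y : `|cos x - cos y| <= `|x - y|.
Proof.
rewrite -[leRHS]mul1r.
by apply: (@derive_bound_lipschitz _ (-%R \o sin)) => c _; rewrite normrN sin_max.
Qed.

Lemma sin_lipschitz x y : `|sin x - sin y| <= `|x - y|.
Proof.
rewrite -[leRHS]mul1r.
by apply: (@derive_bound_lipschitz _ cos) => c _; exact: cos_max.
Qed.

Lemma normr_sin_le x : `|sin x| <= `|x|.
Proof. by have := sin_lipschitz x 0; rewrite sin0 !subr0. Qed.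

Lemma normr_cosB1_le x : `|cos x - 1| <= `|x|.
Proof. by have := cos_lipschitz x 0; rewrite cos0 subr0. Qed.

Let normr_between (c x : R) : Num.min 0 x <= c <= Num.max 0 x -> `|c| <= `|x|.
Proof.
rewrite ge_min le_max => /andP[/orP cl /orP cr].
by case: (ger0P c) => c0; case: (ger0P x) => x0; case: cl => cl; case: cr => cr; lra.
Qed.

Lemma normr_cosB1_le_sqr x : `|cos x - 1| <= x ^+ 2.
Proof.
rewrite -[1](@cos0 R) -real_normK ?num_real// expr2.
have := @derive_bound_lipschitz cos (-%R \o sin) 0 x `|x|; rewrite !subr0; apply => //.
by move=> c /normr_between cx; rewrite normrN (le_trans (normr_sin_le c)).
Qed.

Lemma normr_sinB_le_sqr x : `|sin x - x| <= x ^+ 2.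
Proof.
rewrite -real_normK ?num_real// expr2.
have := @derive_bound_lipschitz (sin \- id) (fun c => cos c - 1) 0 x `|x|.
rewrite /= sin0 !subr0; apply => //.
by move=> c /normr_between cx; rewrite (le_trans (normr_cosB1_le c)).
Qed.

Lemma expR_lipschitz_le0 x y : x <= 0 -> y <= 0 ->
  `|expR x - expR y| <= `|x - y|.
Proof.
move=> x0 y0; rewrite -[leRHS]mul1r.
apply: (@derive_bound_lipschitz _ expR) => c /andP[_].
rewrite le_max => cxy; rewrite ger0_norm ?expR_ge0// -expR0 ler_expR.
by case/orP: cxy => /le_trans; apply.
Qed.

(** The complex exponential on the left half-plane, in coordinates: the real and the imaginary part
    each cost |a - a'| + |b - b'|, hence the factor 2. *)
Lemma exp_polar_lipschitz a b a' b' : a <= 0 :> R -> a' <= 0 :> R ->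
  `|expR a * cos b - expR a' * cos b'| + `|expR a * sin b - expR a' * sin b'|
  <= 2 * (`|a - a'| + `|b - b'|).
Proof.
move=> a0 a'0.
have main (f : R -> R) : (forall x y, `|f x - f y| <= `|x - y|) ->
    (forall x, `|f x| <= 1) ->
    `|expR a * f b - expR a' * f b'| <= `|a - a'| + `|b - b'|.
  move=> fL f1.
  have -> : expR a * f b - expR a' * f b' =
    (expR a - expR a') * f b + expR a' * (f b - f b') by ring.
  rewrite (le_trans (ler_normD _ _))// !normrM lerD//.
    by rewrite -[leRHS]mulr1 ler_pM// expR_lipschitz_le0.
  rewrite -[leRHS]mul1r ler_pM// ger0_norm ?expR_ge0//.
  by rewrite -expR0 ler_expR.
have := main _ cos_lipschitz (@cos_max R).
have := main _ sin_lipschitz (@sin_max R).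
lra.
Qed.

End trigonometric_bounds.

(** * Domination, densities and exchange of integrals *)

Section integration.
Local Open Scope ereal_scope.
Import HBNNSimple.

Lemma integrable_dominated d (T : measurableType d) (R : realType)
    (mu : {measure set T -> \bar R}) (f g : T -> R) :
  measurable_fun setT f -> mu.-integrable setT (EFin \o g) ->
  (forall x, (`|f x| <= g x)%R) -> mu.-integrable setT (EFin \o f).
Proof.
move=> mf ig fg; apply: le_integrable ig => //; first exact/measurable_EFinP.
by move=> x _ /=; rewrite lee_fin (le_trans (fg x)) ?ler_norm.
Qed.

Lemma bounded_integrable_probability d (T : measurableType d) (R : realType)
    (mu : probability T R) (f : T -> R) (k : R) :
  measurable_fun setT f -> (forall x, (`|f x| <= k)%R) ->
  mu.-integrable setT (EFin \o f).
Proof.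
move=> mf fk; apply: (@integrable_dominated _ _ _ _ _ (cst k)) => //.
exact: finite_measure_integrable_cst.
Qed.

(** True on simple functions by the hypothesis on sets, then in the limit by monotone convergence;
    neither measure has to be finite. *)
Lemma integral_with_density d (T : measurableType d) (R : realType)
    (mu nu : {measure set T -> \bar R}) (g : T -> R) :
  measurable_fun setT g -> (forall x, 0 <= g x)%R ->
  (forall A, measurable A -> nu A = \int[mu]_(x in A) (g x)%:E) ->
  forall f : T -> \bar R, measurable_fun setT f -> (forall x, 0 <= f x) ->
  \int[nu]_x f x = \int[mu]_x (f x * (g x)%:E).
Proof.
move=> mg g0 nug f mf f0.
have mgE : measurable_fun setT (EFin \o g) by exact/measurable_EFinP.
pose f_ := nnsfun_approx measurableT mf.
transitivity (lim (\int[nu]_x (f_ n x)%:E @[n --> \oo])).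
  rewrite -monotone_convergence//=.
  - by apply: eq_integral => x _; apply/esym/cvg_lim => //=; exact: cvg_nnsfun_approx.
  - by move=> n; exact/measurable_EFinP.
  - by move=> n x _; rewrite lee_fin.
  - by move=> x _ m n mn; rewrite lee_fin; exact/lefP/nd_nnsfun_approx.
transitivity (lim (\int[mu]_x ((f_ n x)%:E * (g x)%:E) @[n --> \oo])).
  congr (lim (_ @ \oo)); apply/funext => n.
  under eq_integral do rewrite fimfunE -fsumEFin//.
  rewrite ge0_integral_fsum//=; last 2 first.
  - by move=> r; exact/measurable_EFinP/measurableT_comp.
  - by move=> r x _; rewrite EFinM nnfun_muleindic_ge0.
  under [RHS]eq_integral.
    move=> x _; rewrite fimfunE -fsumEFin// ge0_mule_fsuml; last first.
      by move=> r; rewrite EFinM nnfun_muleindic_ge0.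
    over.
  rewrite ge0_integral_fsum//=; last 2 first.
  - move=> r; apply: emeasurable_funM => //.
    exact/measurable_EFinP/measurableT_comp.
  - by move=> r x _; rewrite mule_ge0 ?lee_fin// -lee_fin EFinM nnfun_muleindic_ge0.
  apply: eq_fsbigr => r rf.
  rewrite integralZl_indic_nnsfun//= integral_indic// setIT nug//.
  under [RHS]eq_integral do rewrite EFinM -muleA.
  rewrite ge0_integralZl//; last 3 first.
  - by apply: emeasurable_funM => //; exact/measurable_EFinP.
  - by move=> x _; rewrite mule_ge0 ?lee_fin.
  - by move: rf; rewrite inE /= => -[x _ <-]; rewrite lee_fin.
  congr (_ * _); rewrite integral_mkcond; apply: eq_integral => x _.
  by rewrite patchE indicE; case: ifPn => _; rewrite ?mul1e ?mul0e.
rewrite -monotone_convergence//=.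
- apply: eq_integral => x _; apply/cvg_lim => //.
  by apply: cvgeMr => //; exact: cvg_nnsfun_approx.
- by move=> n; apply: emeasurable_funM => //; exact/measurable_EFinP.
- by move=> n x _; rewrite mule_ge0 ?lee_fin.
- by move=> x _ m n mn; rewrite lee_wpmul2r ?lee_fin//; exact/lefP/nd_nnsfun_approx.
Qed.

Lemma Fubini_dominated d1 d2 (T1 : measurableType d1) (T2 : measurableType d2)
    (R : realType) (m1 : {sigma_finite_measure set T1 -> \bar R})
    (m2 : {sigma_finite_measure set T2 -> \bar R})
    (f : T1 * T2 -> R) (a : T1 -> R) (b : T2 -> R) :
  measurable_fun setT f ->
  m1.-integrable setT (EFin \o a) -> m2.-integrable setT (EFin \o b) ->
  (forall x y, `|f (x, y)| <= a x * b y)%R ->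
  m1.-integrable setT (fun x => (\int[m2]_y f (x, y))%:E) /\
  (\int[m1]_x \int[m2]_y f (x, y) = \int[m2]_y \int[m1]_x f (x, y))%R.
Proof.
move=> mf ia ib fab.
have mfE : measurable_fun setT (EFin \o f) by exact/measurable_EFinP.
have if1 x : m2.-integrable setT (EFin \o (fun y => f (x, y))).
  apply: (@integrable_dominated _ _ _ _ _ (fun y => a x * b y)%R) => //.
    exact: measurableT_comp.
  by under [_ \o _]funext do rewrite /= EFinM; exact: integrableZl.
have if2 y : m1.-integrable setT (EFin \o (fun x => f (x, y))).
  apply: (@integrable_dominated _ _ _ _ _ (fun x => a x * b y)%R) => //.
    exact: measurableT_comp.
  by under [_ \o _]funext do rewrite /= EFinM; exact: integrableZr.
have ipf : (m1 \x m2).-integrable setT (EFin \o f).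
  apply/integrable12ltyP => //.
  (* Only the product [a x * b y] is known to be nonnegative, so Tonelli is applied with the
     absolute values of [a] and [b]. *)
  have ia' : m1.-integrable setT (EFin \o (fun x => `|a x|)%R).
    exact: (integrable_norm ia).
  have ib' : m2.-integrable setT (EFin \o (fun x => `|b x|)%R).
    exact: (integrable_norm ib).
  have ma : measurable_fun setT (fun x => `|a x|%:E) := measurable_int m1 ia'.
  have mb : measurable_fun setT (fun y => `|b y|%:E) := measurable_int m2 ib'.
  apply: (@le_lt_trans _ _ (\int[m1]_x (`|a x|%:E * \int[m2]_y `|b y|%:E))).
    apply: ge0_le_integral => //=.
    - by move=> x _; exact: integral_ge0.
    - apply: (measurable_fun_fubini_tonelli_F (abse \o (EFin \o f))) => //=.
      exact: measurableT_comp.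
    - exact: emeasurable_funM.
    - move=> x _; rewrite -ge0_integralZl//=.
      apply: ge0_le_integral => //=.
      + by apply/measurable_EFinP/measurableT_comp => //; exact: measurableT_comp.
      + exact: emeasurable_funM.
      + move=> y _; rewrite lee_fin -normrM (le_trans (fab x y))//.
        exact: ler_norm.
  rewrite ge0_integralZr//=; last by apply: integral_ge0 => y _; rewrite lee_fin.
  rewrite lte_mul_pinfty//.
  - by apply: integral_ge0 => y _; rewrite lee_fin.
  - exact: (integrable_fin_num measurableT ia').
  - have := integrable_fin_num measurableT ib'.
    by rewrite fin_numElt => /andP[].
have E1 x : \int[m2]_y (f (x, y))%:E = (\int[m2]_y f (x, y))%R%:E.
  by rewrite fineK//; exact: (integrable_fin_num measurableT (if1 x)).
have E2 y : \int[m1]_x (f (x, y))%:E = (\int[m1]_x f (x, y))%R%:E.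
  by rewrite fineK//; exact: (integrable_fin_num measurableT (if2 y)).
split.
  under [fun x => _]funext do rewrite -E1.
  exact: (integrable_fubini_F ipf).
congr fine.
under eq_integral do rewrite -E1.
under [RHS]eq_integral do rewrite -E2.
exact: (Fubini ipf).
Qed.

End integration.

(** * The Laplace representation of the arctangent *)

Section measurability.
Context {R : realType}.

Lemma measurable_cos : measurable_fun setT (@cos R).
Proof. by apply: continuous_measurable_fun; exact: continuous_cos. Qed.

Lemma measurable_sin : measurable_fun setT (@sin R).
Proof. by apply: continuous_measurable_fun; exact: continuous_sin. Qed.

Lemma measurable_atan : measurable_fun setT (@atan R).
Proof. by apply: continuous_measurable_fun; exact: continuous_atan. Qed.

Lemma measurable_invr : measurable_fun setT (@GRing.inv R).
Proof.
rewrite -(setUv [set 0]); apply/measurable_funU => //.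
  exact: measurableC.
split; first exact: measurable_fun_set1.
apply: open_continuous_measurable_fun.
  by apply: closed_openC; exact: closed_eq.
by move=> x; rewrite inE/= => /eqP x0; exact: inv_continuous.
Qed.

End measurability.

Section laplace_weight.
Context {R : realType}.
Notation leb := (@lebesgue_measure R).
Implicit Types t y z : R.

(* Vanishing at 0, it makes the value at 0 of the quotient sin (t * y) / t
   irrelevant. *)
Definition laplace_weight t : R := expR (- t) * \1_(`]0, +oo[) t.

Lemma laplace_weight_ge0 t : 0 <= laplace_weight t.
Proof. by rewrite mulr_ge0 ?expR_ge0// indicE. Qed.

Lemma laplace_weight_le0 t : t <= 0 -> laplace_weight t = 0.
Proof.
move=> t0; rewrite /laplace_weight indicE memNset ?mulr0//=.
by rewrite in_itv/= andbT; apply/negP; rewrite -leNgt.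
Qed.

Lemma measurable_laplace_weight : measurable_fun setT laplace_weight.
Proof.
apply: measurable_funM => //.
by apply: measurableT_comp => //; exact: measurable_expR.
Qed.

Lemma integrable_laplace_weight_poly :
  leb.-integrable setT (EFin \o (fun t => laplace_weight t * (1 + t + t ^+ 2))).
Proof.
(* Half of the decay absorbs the polynomial: 1 + t + t^2 <= 16 e^{t/2}, from 1 + t/2 <= e^{t/2} and
   1 + t^2/8 <= e^{t/2}. The density of rate 1/2 carries a factor 1/2, hence 32. *)
apply: (@integrable_dominated _ (measurableTypeR R) R leb _ (fun t => 32 * exponential_pdf (2^-1) t)).
- apply: measurable_funM; first exact: measurable_laplace_weight.
  apply: measurable_funD; first exact: measurable_funD.
  exact: measurable_funX.
- under [_ \o _]funext do rewrite /= EFinM.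
  by apply: integrableZl => //; exact: integrable_exponential_pdf.
move=> t; have [t0|t0] := leP t 0.
  rewrite laplace_weight_le0// mul0r normr0 mulr_ge0//.
  exact: exponential_pdf_ge0.
rewrite ger0_norm; last first.
  by rewrite mulr_ge0 ?laplace_weight_ge0// addr_ge0 ?sqr_ge0// addr_ge0// ltW.
have -> : exponential_pdf 2^-1 t = 2^-1 * expR (- 2^-1 * t).
  by rewrite exponential_pdfE// ltW.
rewrite /laplace_weight.
rewrite indicE mem_set/= ?in_itv/= ?t0// mulr1.
have -> : - t = - 2^-1 * t + - 2^-1 * t by lra.
have eE : expR (- 2^-1 * t) * expR (2^-1 * t) = 1.
  by rewrite -expRD mulNr addNr expR0.
have h : 0 <= 2^-1 * t by rewrite mulr_ge0// ltW.
have E1 := expR_ge1Dx (2^-1 * t).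
have E2 : 1 + (2^-1 * t) ^+ 2 / 2 <= expR (2^-1 * t).
  exact: (@expR_ge1Dxn R (2^-1 * t) 1).
rewrite expRD; move: eE E1 E2; set e := expR (- _ * _); set E := expR _ => eE E1 E2.
have -> : 32 * (2^-1 * e) = e * e * (16 * E).
  by transitivity (e * (16 * (e * E))); [rewrite eE; field|ring].
rewrite ler_wpM2l ?mulr_ge0 ?expR_ge0//.
by move: E1 E2; rewrite !expr2; nra.
Qed.

Lemma integrable_laplace_weightM (g : R -> R) (k : R) :
  measurable_fun setT g ->
  (forall t, 0 < t -> `|g t| <= k * (1 + t + t ^+ 2)) ->
  leb.-integrable setT (EFin \o (fun t => laplace_weight t * g t)).
Proof.
move=> mg gk.
apply: (@integrable_dominated _ (measurableTypeR R) R leb _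
  (fun t => k * (laplace_weight t * (1 + t + t ^+ 2)))).
- by apply: measurable_funM => //; exact: measurable_laplace_weight.
- under [_ \o _]funext do rewrite /= EFinM.
  by apply: integrableZl => //; exact: integrable_laplace_weight_poly.
move=> t; have [t0|t0] := leP t 0.
  by rewrite laplace_weight_le0// !mul0r mulr0 normr0.
rewrite normrM (ger0_norm (laplace_weight_ge0 _)) mulrCA.
by rewrite ler_wpM2l ?laplace_weight_ge0// gk.
Qed.

Lemma integrable_laplace_weight :
  leb.-integrable setT (EFin \o laplace_weight).
Proof.
under [_ \o _]funext do rewrite /= -[laplace_weight _]mulr1.
apply: (@integrable_laplace_weightM (cst 1) 1) => // t t0.
by rewrite normr1 mul1r -addrA lerDl addr_ge0 ?sqr_ge0// ltW.
Qed.

Lemma measurable_cosM z : measurable_fun setT (fun t => cos (t * z)).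
Proof.
apply: (measurableT_comp measurable_cos).
exact: measurable_funM.
Qed.

Lemma measurable_sinM z : measurable_fun setT (fun t => sin (t * z)).
Proof.
apply: (measurableT_comp measurable_sin).
exact: measurable_funM.
Qed.

(** The constant 1 makes the integrand nonnegative, as the fundamental theorem of calculus on the
    half-line requires; it is subtracted afterwards. *)
Let integral_laplace_weight1Dcos z :
  \int[leb]_t (laplace_weight t * (1 + cos (t * z))) = 1 + (oneDsqr z)^-1.
Proof.
(* The sum of - e^{-t} and of the antiderivative of e^{-t} cos(t z) found by two integrations by
   parts. *)
pose F t : R := expR (- t) * (- 1 + (oneDsqr z)^-1 * (z * sin (t * z) - cos (t * z))).
pose f t : R := expR (- t) * (1 + cos (t * z)).
have z0 : oneDsqr z != 0 by rewrite gt_eqF// oneDsqr_gt0.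
have dF t : is_derive t (1 : R) F (f t).
  rewrite /F; apply: is_derive_eq.
  rewrite /f /GRing.scale /=.
  have : (oneDsqr z)^-1 * (1 + z ^+ 2) = 1 by rewrite mulVf.
  set s := sin _; set c := cos _; set e := expR _; set i := _^-1 => h.
  transitivity (e * (1 + c * (i * (1 + z ^+ 2)))); last by rewrite h mulr1.
  by ring.
have Fcvg : F t @[t --> +oo] --> (0 : R).
  pose k : R := 1 + (`|z| + 1).
  have Fk t : `|F t| <= k * expR (- t).
    rewrite /F normrM ger0_norm ?expR_ge0// mulrC ler_wpM2r ?expR_ge0//.
    rewrite (le_trans (ler_normD _ _))// normrN1 lerD2l normrM.
    rewrite -[leRHS]mul1r ler_pM//.
      by rewrite ger0_norm ?invr_ge0//; exact: oneDsqrV_le1.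
    rewrite (le_trans (ler_normB _ _))// lerD ?cos_max// normrM.
    by rewrite -[leRHS]mulr1 ler_wpM2l// sin_max.
  apply: norm_cvg0; apply: (@squeeze_cvgr _ _ _ _ (cst 0) (fun t => k * expR (- t))).
  - by near=> t; rewrite normr_ge0 Fk.
  - exact: cvg_cst.
  - by rewrite -[0](mulr0 k); apply: cvgMr; exact: cvgr_expR.
transitivity (\int[leb]_(t in `[0, +oo[) f t).
  rewrite -Rintegral_itv_obnd_cbnd; last first.
    have iw : leb.-integrable setT (EFin \o (fun t => laplace_weight t * (1 + cos (t * z)))).
      apply: (@integrable_laplace_weightM _ 2).
        by apply: measurable_funD => //; exact: measurable_cosM.
      move=> t t0; have := cos_max (t * z); have := sqr_ge0 t.
      by rewrite !ler_norml; lra.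
    have {}iw : leb.-integrable `]0, +oo[
        (EFin \o (fun t => laplace_weight t * (1 + cos (t * z)))).
      by apply: integrableS iw => //.
    apply: eq_integrable iw => // t t0 /=.
    by rewrite /laplace_weight indicE t0 mulr1.
  rewrite [RHS]Rintegral_mkcond; apply: eq_Rintegral => t _.
  rewrite patchE /laplace_weight indicE /f; case: ifPn => t0.
    by rewrite mulr1.
  by rewrite mulr0 mul0r.
rewrite (@Rintegral_ge0_continuous_FTC2y _ f F 0 0)//.
- by rewrite /F oppr0 expR0 mul0r sin0 cos0; lra.
- by move=> t _; rewrite mulr_ge0 ?expR_ge0// -lerBlDl sub0r cos_geN1.
- apply: continuous_subspaceT => t; apply: differentiable_continuous.
  by apply/derivable1_diffP.
- apply: cvg_at_right_filter; apply: differentiable_continuous.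
  by apply/derivable1_diffP.
- by move=> t _; rewrite derive1E; exact: derive_val.
Unshelve. all: by end_near. Qed.

Lemma integral_laplace_weight_cos z :
  \int[leb]_t (laplace_weight t * cos (t * z)) = (oneDsqr z)^-1.
Proof.
have iw := integrable_laplace_weight.
(* At z = 0 the previous identity says that twice this integral is 2. *)
have w1 : \int[leb]_t laplace_weight t = 1.
  have := integral_laplace_weight1Dcos 0.
  under eq_Rintegral do rewrite mulr0 cos0.
  rewrite RintegralZr// => /(canRL (mulfK _)) -> //.
  by rewrite /oneDsqr expr0n addr0 invr1 mulfV.
have := integral_laplace_weight1Dcos z.
under eq_Rintegral do rewrite mulrDr mulr1.
rewrite RintegralD// ?w1; first by move=> /addrI.
apply: (@integrable_laplace_weightM _ 1); first exact: measurable_cosM.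
move=> t t0; rewrite (le_trans (cos_max _))// mul1r -addrA lerDl.
by rewrite addr_ge0 ?sqr_ge0// ltW.
Qed.

Lemma integral_cosM t y : 0 <= y -> t != 0 ->
  \int[leb]_(z in `[0, y]) cos (t * z) = sin (t * y) / t.
Proof.
rewrite le_eqVlt => /predU1P[<- _|y0 t0].
  by rewrite set_itv1 Rintegral_set1 mulr0 sin0 mul0r.
pose F z : R := t^-1 * sin (t * z).
have dF z : is_derive z (1 : R) F (cos (t * z)).
  rewrite /F; apply: is_derive_eq.
  by rewrite /GRing.scale /=; field.
rewrite /Rintegral (@continuous_FTC2 _ _ F)//.
- by rewrite /F mulr0 sin0 mulr0 sube0 mulrC.
- apply: continuous_subspaceT => z; apply: differentiable_continuous.
  by apply/derivable1_diffP.
- split => [z _||].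
  + exact: ex_derive.
  + by apply: cvg_at_right_filter; apply: differentiable_continuous; exact/derivable1_diffP.
  + by apply: cvg_at_left_filter; apply: differentiable_continuous; exact/derivable1_diffP.
- by move=> z _; rewrite derive1E; exact: derive_val.
Qed.

(** Integrate the cosine transform 1 / (1 + z^2) of the weight over z in [0, y] and exchange the
    integrals: one order gives atan y, the other sin(t y) / t. Both sides are odd in y, which
    reduces to y >= 0. *)
Lemma atan_laplace y :
  atan y = \int[leb]_t (laplace_weight t * (sin (t * y) / t)).
Proof.
wlog y0 : y / 0 <= y => [H|].
  have [/H//|/ltW y0] := leP 0 y.
  have {H} := H (- y); rewrite oppr_ge0 => /(_ y0); rewrite atanN => /eqP.
  rewrite eqr_oppLR => /eqP ->.
  rewrite -mulN1r -RintegralZl//; last first.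
    apply: (@integrable_laplace_weightM _ `|y|).
      apply: measurable_funM; first exact: measurable_sinM.
      exact: measurable_invr.
    move=> t t0; rewrite normrM normfV ler_pdivrMr ?normr_gt0 ?gt_eqF//.
    rewrite (le_trans (normr_sin_le _))// normrM normrN mulrC ler_wpM2r//.
    by rewrite -[leLHS]mulr1 ler_wpM2l// -addrA lerDl addr_ge0 ?sqr_ge0// ltW.
  by apply: eq_Rintegral => t _; rewrite mulN1r mulrN sinN !mulNr mulrN opprK.
pose f (zt : R * R) : R := \1_(`[0, y]) zt.1 * (laplace_weight zt.2 * cos (zt.2 * zt.1)).
have [] := @Fubini_dominated _ _ _ _ R leb leb f \1_(`[0, y]) laplace_weight.
- apply: measurable_funM; first exact: measurableT_comp.
  apply: measurable_funM; first exact: (measurableT_comp measurable_laplace_weight).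
  apply: (measurableT_comp measurable_cos).
  exact: measurable_funM.
- apply: integrable_indic_itv.
- exact: integrable_laplace_weight.
- move=> z t; rewrite /f /= normrM [X in X * _]ger0_norm ?indicE//.
  rewrite ler_wpM2l// normrM (ger0_norm (laplace_weight_ge0 _)).
  by rewrite -[leRHS]mulr1 ler_wpM2l ?cos_max// laplace_weight_ge0.
move=> _ fub.
transitivity (\int[leb]_z \int[leb]_t f (z, t)).
  rewrite -(integral0_oneDsqr y0) [LHS]Rintegral_mkcond; apply: eq_Rintegral => z _.
  rewrite /f /= RintegralZl//; last first.
    apply: (@integrable_laplace_weightM _ 1); first exact: measurable_cosM.
    move=> t t0; rewrite (le_trans (cos_max _))// mul1r -addrA lerDl.
    by rewrite addr_ge0 ?sqr_ge0// ltW.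
  rewrite integral_laplace_weight_cos patchE indicE.
  by case: ifPn; rewrite (mul1r, mul0r).
rewrite fub; apply: eq_Rintegral => t _; rewrite /f /=.
have [t0|t0] := leP t 0.
  rewrite laplace_weight_le0// !mul0r -[RHS](Rintegral_set0 leb (cst 0)).
  rewrite Rintegral_set0; under eq_Rintegral do rewrite mul0r mulr0.
  by rewrite Rintegral_cst// mul0r.
have tn0 : t != 0 by rewrite gt_eqF.
rewrite -(integral_cosM y0 tn0) -[RHS]RintegralZl//; last first.
  by apply: continuous_compact_integrable; [exact: segment_compact|
    apply: continuous_subspaceT => z; apply: continuous_comp;
      [exact: mulrl_continuous|exact: continuous_cos]].
rewrite [RHS]Rintegral_mkcond; apply: eq_Rintegral => z _.
by rewrite patchE indicE; case: ifPn; rewrite (mul1r, mul0r).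
Qed.

End laplace_weight.

(** * The mass of the Cauchy kernel on half-lines, on the line and on symmetric intervals *)

Section cauchy_kernel.
Context {R : realType}.
Notation leb := (@lebesgue_measure R).
Local Open Scope ereal_scope.

Lemma measurable_oneDsqrV : measurable_fun setT (fun z : R => (oneDsqr z)^-1%R).
Proof. by apply: continuous_measurable_fun; exact: continuous_oneDsqrV. Qed.

Lemma integraly_oneDsqr (y : R) :
  \int[leb]_(z in `[y, +oo[) (oneDsqr z)^-1%:E = (pi / 2 - atan y)%:E.
Proof.
rewrite (ge0_continuous_FTC2y _ _ (@cvgy_atan R))//.
- by apply: continuous_subspaceT; exact: continuous_oneDsqrV.
- by apply: cvg_at_right_filter; exact: continuous_atan.
- by move=> x _; rewrite derive1E; exact: derive_val.
Qed.

Lemma integralT_oneDsqr : \int[leb]_z (oneDsqr (z : R))^-1%:E = pi%:E.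
Proof.
rewrite ge0_symfun_integralT.
- by rewrite -set_itvcy integral0y_oneDsqr -EFinM mulrC divfK.
- by move=> x; rewrite invr_ge0.
- exact: continuous_oneDsqrV.
- by move=> x; rewrite /= /oneDsqr sqrrN.
Qed.

Lemma integrable_oneDsqrV : leb.-integrable setT (fun z : R => (oneDsqr z)^-1%:E).
Proof.
apply/integrableP; split.
  by apply/measurable_EFinP; exact: measurable_oneDsqrV.
under eq_integral do rewrite gee0_abs ?lee_fin ?invr_ge0//.
by rewrite integralT_oneDsqr ltry.
Qed.

Lemma integral_oneDsqr_sym (b : R) : (0 < b)%R ->
  (\int[leb]_(z in `[- b, b]) (oneDsqr z)^-1 = 2 * atan b)%R.
Proof.
move=> b0; rewrite /Rintegral (@continuous_FTC2 _ _ atan).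
- by rewrite atanN -EFinB opprK mulr2n mulrDl !mul1r.
- by rewrite gtrN.
- by apply: continuous_subspaceT; exact: continuous_oneDsqrV.
- split => [z _||].
  + exact: ex_derive.
  + by apply: cvg_at_right_filter; exact: continuous_atan.
  + by apply: cvg_at_left_filter; exact: continuous_atan.
- by move=> x _; rewrite derive1E; exact: derive_val.
Qed.

End cauchy_kernel.

(** * Smoothing by the Cauchy kernel *)

Lemma Rintegral_probability_cst d (T : measurableType d) (R : realType)
  (mu : probability T R) (c : R) : \int[mu]_(u in setT) c = c.
Proof. by rewrite /Rintegral integral_cst//= probability_setT mule1. Qed.

Section smoothing.
Context {R : realType}.
Notation leb := (@lebesgue_measure R).
Implicit Types mu : probability R R.

(** With [sin_transform], the real and imaginary parts of the characteristic function; the analysis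
    below stays over the reals. *)
Definition cos_transform mu (t : R) : R := \int[mu]_u cos (t * u).
Definition sin_transform mu (t : R) : R := \int[mu]_u sin (t * u).
Definition distribution_function mu (x : R) : R := fine (mu `]-oo, x]%classic).
(** Its value is 0! + 1! + 2! = 4; it is kept as a symbol in the final constant. *)
Definition laplace_weight_moment : R :=
  \int[leb]_t (laplace_weight t * (1 + t + t ^+ 2)).

Lemma laplace_weight_moment_ge0 : 0 <= laplace_weight_moment.
Proof.
apply: Rintegral_ge0 => t _; have [t0|t0] := leP t 0.
  by rewrite laplace_weight_le0// mul0r.
by rewrite mulr_ge0 ?laplace_weight_ge0// addr_ge0 ?sqr_ge0// addr_ge0// ltW.
Qed.

Lemma measurable_cosMl (t : R) : measurable_fun setT (fun u => cos (t * u)).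
Proof. by apply: (measurableT_comp measurable_cos); exact: measurable_funM. Qed.

Lemma measurable_sinMl (t : R) : measurable_fun setT (fun u => sin (t * u)).
Proof. by apply: (measurableT_comp measurable_sin); exact: measurable_funM. Qed.

Lemma integrable_cosMl mu (t : R) :
  mu.-integrable setT (EFin \o (fun u => cos (t * u))).
Proof.
apply: (@bounded_integrable_probability _ _ _ _ _ 1); first exact: measurable_cosMl.
by move=> u; exact: cos_max.
Qed.

Lemma integrable_sinMl mu (t : R) :
  mu.-integrable setT (EFin \o (fun u => sin (t * u))).
Proof.
apply: (@bounded_integrable_probability _ _ _ _ _ 1); first exact: measurable_sinMl.
by move=> u; exact: sin_max.
Qed.

(** The integrand of the Laplace representation of atan ((u - x) / dlt), at (t, u). *)
Let sinc (x dlt : R) (tu : R * R) : R :=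
  laplace_weight tu.1 * (sin (tu.1 * ((tu.2 - x) / dlt)) / tu.1).

(** The bound of |sin| by the absolute value of its argument cancels 1 / t, so the first moment of
    [mu] suffices for domination. *)
Let sinc_Fubini mu (x dlt : R) :
  mu.-integrable setT (EFin \o (fun u => u)) ->
  leb.-integrable setT (fun t => (\int[mu]_u sinc x dlt (t, u))%:E) /\
  \int[mu]_u atan ((u - x) / dlt) = \int[leb]_t \int[mu]_u sinc x dlt (t, u).
Proof.
move=> iu.
have [] := @Fubini_dominated _ _ _ _ R leb mu (sinc x dlt) laplace_weight
   (fun u => `|(u - x) / dlt|).
- have m1 : measurable_fun [set: measurableTypeR R * R] (fun tu => tu.1 : R).
    exact: measurable_fst.
  have m2 : measurable_fun [set: measurableTypeR R * R] (fun tu => tu.2 : R).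
    exact: measurable_snd.
  apply: measurable_funM; first exact: (measurableT_comp measurable_laplace_weight).
  apply: measurable_funM; last exact: (measurableT_comp measurable_invr).
  apply: (measurableT_comp measurable_sin); apply: measurable_funM => //.
  by apply: measurable_funM => //; exact: measurable_funB.
- exact: integrable_laplace_weight.
- suff h : mu.-integrable setT (EFin \o (fun u => (u - x) / dlt)).
    exact: (integrable_norm h).
  under [_ \o _]funext do rewrite /= EFinM.
  apply: integrableZr => //; under [fun u => _]funext do rewrite EFinB.
  by apply: integrableB => //; exact: finite_measure_integrable_cst.
- move=> t u; rewrite /sinc /=; have [t0|t0] := leP t 0.
    by rewrite laplace_weight_le0// !mul0r normr0.
  rewrite normrM (ger0_norm (laplace_weight_ge0 _)) ler_wpM2l ?laplace_weight_ge0//.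
  rewrite normrM normfV ler_pdivrMr ?normr_gt0 ?gt_eqF//.
  by rewrite (le_trans (normr_sin_le _))// normrM mulrC.
move=> ig ->; split=> //; apply: eq_Rintegral => u _; exact: atan_laplace.
Qed.

Let sinc_transform mu (x dlt t : R) : 0 < dlt -> 0 < t ->
  \int[mu]_u sinc x dlt (t, u) = laplace_weight t / t *
    (sin_transform mu (t / dlt) * cos (t / dlt * x) -
     cos_transform mu (t / dlt) * sin (t / dlt * x)).
Proof.
move=> d0 t0; set s := t / dlt.
transitivity (\int[mu]_u (laplace_weight t / t *
    (sin (s * u) * cos (s * x) - cos (s * u) * sin (s * x)))).
  apply: eq_Rintegral => u _; rewrite /sinc /=.
  have -> : t * ((u - x) / dlt) = s * u - s * x.
    by rewrite /s; field; rewrite gt_eqF.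
  by rewrite sinB; ring.
have i1 : mu.-integrable setT (EFin \o (fun u => sin (s * u) * cos (s * x))).
  under [_ \o _]funext do rewrite /= EFinM.
  by apply: integrableZr => //; exact: integrable_sinMl.
have i2 : mu.-integrable setT (EFin \o (fun u => cos (s * u) * sin (s * x))).
  under [_ \o _]funext do rewrite /= EFinM.
  by apply: integrableZr => //; exact: integrable_cosMl.
rewrite RintegralZl//; last first.
  under [_ \o _]funext do rewrite /= EFinB.
  exact: integrableB.
rewrite (RintegralB measurableT i1 i2).
rewrite (RintegralZr _ measurableT (integrable_sinMl mu s)).
by rewrite (RintegralZr _ measurableT (integrable_cosMl mu s)).
Qed.

Lemma atan_integral_diff mu mu' (x dlt k : R) :
  mu.-integrable setT (EFin \o (fun u => u)) ->
  mu'.-integrable setT (EFin \o (fun u => u)) ->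
  0 < dlt -> dlt <= 1 -> 0 <= k ->
  (forall t, 0 < t ->
    `|cos_transform mu t - cos_transform mu' t| +
    `|sin_transform mu t - sin_transform mu' t| <= k * (t + t ^+ 2 + t ^+ 3)) ->
  `|\int[mu]_u atan ((u - x) / dlt) - \int[mu']_u atan ((u - x) / dlt)|
  <= k / dlt ^+ 3 * laplace_weight_moment.
Proof.
move=> iu iu' d0 d1 k0 hk.
have [ig ->] := sinc_Fubini x dlt iu; have [ig' ->] := sinc_Fubini x dlt iu'.
have iB : leb.-integrable setT (EFin \o (fun t =>
    \int[mu]_u sinc x dlt (t, u) - \int[mu']_u sinc x dlt (t, u))).
  under [_ \o _]funext do rewrite /= EFinB.
  exact: integrableB.
rewrite -RintegralB// (le_trans (le_normr_Rintegral _ iB))//.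
rewrite /laplace_weight_moment -RintegralZl//; last first.
  exact: integrable_laplace_weight_poly.
apply: le_Rintegral => //.
- exact: (integrable_norm iB).
- under [_ \o _]funext do rewrite /= EFinM.
  by apply: integrableZl => //; exact: integrable_laplace_weight_poly.
suff main (t : R) : `|\int[mu]_u sinc x dlt (t, u) - \int[mu']_u sinc x dlt (t, u)| <=
    k / dlt ^+ 3 * (laplace_weight t * (1 + t + t ^+ 2)) by move=> t _; exact: main.
have [t0|t0] := leP t 0.
  rewrite /sinc /= laplace_weight_le0// mul0r mulr0.
  under eq_Rintegral do rewrite mul0r.
  under [X in _ - X]eq_Rintegral do rewrite mul0r.
  by rewrite !Rintegral_cst// !mul0r subrr normr0.
rewrite !sinc_transform//; set s := t / dlt.
have s0 : 0 < s by rewrite divr_gt0.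
rewrite -mulrBr normrM (ger0_norm (divr_ge0 (laplace_weight_ge0 t) (ltW t0))).
have {}hk := hk _ s0.
rewrite [X in _ <= X]mulrCA -mulrA ler_wpM2l ?laplace_weight_ge0//.
apply: (@le_trans _ _ (t^-1 * (k * (s + s ^+ 2 + s ^+ 3)))).
  have ti0 : 0 <= t^-1 by rewrite invr_ge0 ltW.
  rewrite ler_wpM2l//; apply: le_trans hk.
  rewrite (_ : _ - _ =
    (sin_transform mu s - sin_transform mu' s) * cos (s * x) -
    (cos_transform mu s - cos_transform mu' s) * sin (s * x)); last by ring.
  rewrite (le_trans (ler_normB _ _))// addrC !normrM lerD//.
    by rewrite -[leRHS]mulr1 ler_wpM2l// sin_max.
  by rewrite -[leRHS]mulr1 ler_wpM2l// cos_max.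
(* The factor 1 / t lowers each power of t by one; [dlt <= 1] then bounds the coefficients dlt^2 and
   dlt by 1. *)
have -> : t^-1 * (k * (s + s ^+ 2 + s ^+ 3)) =
    k / dlt ^+ 3 * (dlt ^+ 2 + dlt * t + t ^+ 2).
  by rewrite /s; field; rewrite !gt_eqF.
rewrite ler_wpM2l ?divr_ge0 ?exprn_ge0 ?(ltW d0)// lerD// lerD//.
  by rewrite exprn_ile1// ltW.
by rewrite ler_piMl// ltW.
Qed.

Lemma distribution_function_itv01 mu x : 0 <= distribution_function mu x <= 1.
Proof.
rewrite fine_ge0//= -lee_fin fineK ?probability_le1//.
exact: fin_num_measure.
Qed.

Lemma le_distribution_function mu x y :
  x <= y -> distribution_function mu x <= distribution_function mu y.
Proof.
move=> xy; rewrite fine_le ?fin_num_measure//.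
by rewrite le_measure ?inE//; apply: subset_itvl; rewrite bnd_simp.
Qed.

Lemma measurable_distribution_function mu :
  measurable_fun setT (distribution_function mu).
Proof.
by apply: nondecreasing_measurable => // x y; exact: le_distribution_function.
Qed.

(** Write the distribution function as the [mu]-integral of the indicator of u <= x + dlt z and
    integrate in z first: what remains is the Cauchy mass of z >= (u - x) / dlt. *)
Lemma cauchy_smoothing mu (x dlt : R) : 0 < dlt ->
  \int[leb]_z ((oneDsqr z)^-1 * distribution_function mu (x + dlt * z)) =
  pi / 2 - \int[mu]_u atan ((u - x) / dlt).
Proof.
move=> d0.
(* The indicator is a function of a difference so that joint measurability follows by composition;
   [fE] and [fE'] read it as an indicator in u and in z. *)
pose f (zu : R * R) : R := (oneDsqr zu.1)^-1 * \1_(`]-oo, 0]) (zu.2 - (x + dlt * zu.1)).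
have fE z u : f (z, u) = (oneDsqr z)^-1 * \1_(`]-oo, x + dlt * z]) u.
  by rewrite /f !indicE /= !mem_setE !in_itv /= subr_le0.
have fE' z u : f (z, u) = (oneDsqr z)^-1 * \1_(`[(u - x) / dlt, +oo[) z.
  rewrite /f !indicE /= !mem_setE !in_itv /= andbT ler_pdivrMr//.
  by rewrite subr_le0 lerBlDl (mulrC dlt).
have [] := @Fubini_dominated _ _ _ _ R leb mu f (fun z => (oneDsqr z)^-1) (cst 1).
- have m1 : measurable_fun [set: measurableTypeR R * R] (fun zu => zu.1 : R).
    exact: measurable_fst.
  have m2 : measurable_fun [set: measurableTypeR R * R] (fun zu => zu.2 : R).
    exact: measurable_snd.
  apply: measurable_funM; first exact: (measurableT_comp measurable_oneDsqrV).
  apply: measurableT_comp => //; apply: measurable_funB => //.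
  by apply: measurable_funD => //; exact: measurable_funM.
- exact: integrable_oneDsqrV.
- exact: finite_measure_integrable_cst.
- move=> z u; rewrite /f normrM /= mulr1 ger0_norm ?invr_ge0//.
  by rewrite -[leRHS]mulr1 ler_wpM2l ?invr_ge0// ger0_norm// indicE lern1 leq_b1.
move=> _ fub.
transitivity (\int[leb]_z \int[mu]_u f (z, u)).
  apply: eq_Rintegral => z _.
  under [RHS]eq_Rintegral do rewrite fE.
  rewrite RintegralZl//; last first.
    by apply: (@bounded_integrable_probability _ _ _ _ _ 1) => // u;
      rewrite ger0_norm// indicE lern1 leq_b1.
  by congr (_ * _); rewrite /Rintegral integral_indic// setIT.
rewrite fub.
transitivity (\int[mu]_u (pi / 2 - atan ((u - x) / dlt))).
  apply: eq_Rintegral => u _.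
  under eq_Rintegral do rewrite fE'.
  transitivity (\int[leb]_(z in `[((u - x) / dlt), +oo[) (oneDsqr z)^-1).
    rewrite [RHS]Rintegral_mkcond; apply: eq_Rintegral => z _.
    by rewrite patchE indicE; case: ifPn; rewrite (mulr1, mulr0).
  by rewrite /Rintegral integraly_oneDsqr.
rewrite RintegralB//.
- by rewrite Rintegral_probability_cst.
- exact: finite_measure_integrable_cst.
apply: (@bounded_integrable_probability _ _ _ _ _ (pi / 2)).
  apply: (measurableT_comp measurable_atan).
  by apply: measurable_funM => //; exact: measurable_funB.
by move=> u; rewrite ler_norml !ltW ?atan_gtNpi2 ?atan_ltpi2.
Qed.

(** For z in [- b, b], of Cauchy mass 2 atan b, the argument of [h] runs through the window from a
    to a + 2 dlt b, where h >= d. On the remaining mass pi - 2 atan b only h >= - D is known. *)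
Let cauchy_lower_bound (h : R -> R) (D a b dlt d : R) :
  measurable_fun setT h -> (forall x, `|h x| <= D) -> 0 < dlt -> 0 < b ->
  (forall w, a <= w <= a + 2 * dlt * b -> d <= h w) ->
  (d + D) * (2 * atan b) - D * pi <=
  \int[leb]_z ((oneDsqr z)^-1 * h (a + dlt * b + dlt * z)).
Proof.
move=> mh hD d0 b0 hd.
have iK := @integrable_oneDsqrV R.
have iKb : leb.-integrable setT (EFin \o (fun z => (oneDsqr z)^-1 * \1_(`[- b, b]) z)).
  apply: (@integrable_dominated _ _ R leb _ (fun z => (oneDsqr z)^-1)) => //.
    by apply: measurable_funM => //; exact: measurable_oneDsqrV.
  move=> z; rewrite normrM ger0_norm ?invr_ge0//.
  by rewrite -[leRHS]mulr1 ler_wpM2l ?invr_ge0// ger0_norm// indicE lern1 leq_b1.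
have iL : leb.-integrable setT (EFin \o
    (fun z => (d + D) * ((oneDsqr z)^-1 * \1_(`[- b, b]) z) - D * (oneDsqr z)^-1)).
  under [_ \o _]funext do rewrite /= EFinB !(EFinM (d + D)) (EFinM D).
  by apply: integrableB => //; apply: integrableZl.
have KT : \int[leb]_z (oneDsqr z)^-1 = pi by rewrite /Rintegral integralT_oneDsqr.
have Kb : \int[leb]_z ((oneDsqr z)^-1 * \1_(`[- b, b]) z) = 2 * atan b.
  rewrite -integral_oneDsqr_sym// [RHS]Rintegral_mkcond; apply: eq_Rintegral => z _.
  by rewrite patchE indicE; case: ifPn; rewrite (mulr1, mulr0).
have -> : (d + D) * (2 * atan b) - D * pi = \int[leb]_z
    ((d + D) * ((oneDsqr z)^-1 * \1_(`[- b, b]) z) - D * (oneDsqr z)^-1).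
  rewrite RintegralB//.
  - by rewrite !RintegralZl// Kb KT.
  - by under [_ \o _]funext do rewrite /= EFinM; exact: integrableZl.
  - by under [_ \o _]funext do rewrite /= EFinM; exact: integrableZl.
apply: le_Rintegral => //.
  apply: (@integrable_dominated _ _ R leb _ (fun z => D * (oneDsqr z)^-1)).
  - apply: measurable_funM; first exact: measurable_oneDsqrV.
    apply: measurableT_comp => //; apply: measurable_funD => //.
  - by under [_ \o _]funext do rewrite /= EFinM; exact: integrableZl.
  - move=> z; rewrite normrM ger0_norm ?invr_ge0// mulrC.
    by rewrite ler_wpM2r ?invr_ge0.
move=> z _; rewrite (mulrC (d + D)) -mulrA (mulrC D) -mulrBr.
rewrite ler_wpM2l ?invr_ge0// indicE.
have := hD (a + dlt * b + dlt * z); rewrite ler_norml => /andP[hD1 _].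
case: (boolP (z \in _)); last by rewrite mul0r sub0r.
rewrite mem_setE in_itv/= => /andP[bz zb].
by rewrite mul1r addrK hd//; nra.
Qed.

(* With three quarters of the Cauchy mass within distance b of 0,
   the smoothed difference sees the largest difference of the distribution
   functions up to a factor 1/3 of itself, which can be absorbed. *)
Lemma kolmogorov_smoothing mu mu' (M B dlt : R) :
  0 < dlt -> 0 <= M ->
  (forall x y, x <= y ->
    distribution_function mu' y <= distribution_function mu' x + M * (y - x)) ->
  (forall x, `|\int[mu]_u atan ((u - x) / dlt) -
               \int[mu']_u atan ((u - x) / dlt)| <= B) ->
  forall y, `|distribution_function mu y - distribution_function mu' y| <=
    B + 3 * dlt * tan (pi * (3 / 8)) * M.
Proof.
move=> d0 M0 hM hB.
set F := distribution_function mu; set G := distribution_function mu'.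
set b : R := tan _; pose D := sup (range (fun y => `|F y - G y|)).
have pi0 := @pi_gt0 R.
have atb : atan b = pi * (3 / 8).
  by rewrite /b tanK// in_itv/=; apply/andP; split; lra.
have b0 : 0 < b.
  rewrite /b /tan divr_gt0// ?cos_gt0_pihalf ?sin_gt0_pihalf//; lra.
have FG1 y : `|F y - G y| <= 1.
  have /andP[] := distribution_function_itv01 mu y.
  have /andP[] := distribution_function_itv01 mu' y.
  by rewrite -/F -/G ler_norml; lra.
have hs : has_sup (range (fun y => `|F y - G y|)).
  by split; [exists `|F 0 - G 0|, 0|exists 1 => _ [y _ <-]].
have hD y : `|F y - G y| <= D by apply: sup_upper_bound => //; exists y.
have mFG : measurable_fun setT (fun y => F y - G y).
  by apply: measurable_funB; exact: measurable_distribution_function.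
have mGF : measurable_fun setT (fun y => G y - F y).
  by apply: measurable_funB; exact: measurable_distribution_function.
have sm (P Q : probability R R) x : \int[leb]_z ((oneDsqr z)^-1 *
      (distribution_function P (x + dlt * z) - distribution_function Q (x + dlt * z))) =
    \int[Q]_u atan ((u - x) / dlt) - \int[P]_u atan ((u - x) / dlt).
  have iF (S : probability R R) : leb.-integrable setT (EFin \o
      (fun z => (oneDsqr z)^-1 * distribution_function S (x + dlt * z))).
    apply: (@integrable_dominated _ _ R leb _ (fun z => (oneDsqr z)^-1)).
    - apply: measurable_funM; first exact: measurable_oneDsqrV.
      apply: (measurableT_comp (measurable_distribution_function S)).
      by apply: measurable_funD => //; exact: measurable_funM.
    - exact: integrable_oneDsqrV.
    - move=> z; have /andP[P0 P1] := distribution_function_itv01 S (x + dlt * z).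
      rewrite ger0_norm ?mulr_ge0 ?invr_ge0//.
      by rewrite -[leRHS]mulr1 ler_wpM2l ?invr_ge0.
  under eq_Rintegral do rewrite mulrBr.
  rewrite (RintegralB measurableT (iF P) (iF Q)) !cauchy_smoothing//; lra.
have step y : `|F y - G y| <= D / 3 + (4 / (3 * pi)) * B + 2 * dlt * b * M.
  (* The window starts at y if F y >= G y and ends at y otherwise. Along it [F] moves in the
     favourable direction by monotonicity, and [G] in the unfavourable one by at most M times the
     length 2 dlt b, so the difference stays above [d]. *)
  set d := `|F y - G y| - 2 * dlt * b * M.
  have [x hx] : exists x, (d + D) * (2 * atan b) - D * pi <=
    `|\int[mu']_u atan ((u - x) / dlt) - \int[mu]_u atan ((u - x) / dlt)|.
    have db0 : 0 < dlt * b by rewrite mulr_gt0.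
    have [FG0|FG0] := leP 0 (F y - G y).
      exists (y + dlt * b); rewrite -(sm mu mu').
      apply: (le_trans _ (ler_norm _)).
      apply: (@cauchy_lower_bound (fun w => F w - G w)) => // w /andP[yw wy].
      rewrite /d (ger0_norm FG0).
      have := hM _ _ yw; have := le_distribution_function mu yw; rewrite -/F -/G.
      have : M * (w - y) <= M * (2 * dlt * b) by rewrite ler_wpM2l//; lra.
      lra.
    exists (y - 2 * dlt * b + dlt * b); rewrite distrC -(sm mu' mu).
    apply: (le_trans _ (ler_norm _)).
    apply: (@cauchy_lower_bound (fun y => G y - F y)) => //.
      by move=> x; rewrite distrC.
    move=> w /andP[yw]; rewrite subrK => wy.
    rewrite /d (ltr0_norm FG0).
    have := hM _ _ wy; have := le_distribution_function mu wy; rewrite -/F -/G.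
    have : M * (y - w) <= M * (2 * dlt * b) by rewrite ler_wpM2l//; lra.
    lra.
  have {hx} := le_trans hx _; rewrite distrC => /(_ _ (hB x)).
  rewrite atb /d; set e := 2 * dlt * b * M => h.
  have h1 : pi * (3 * `|F y - G y|) <= pi * (D + 3 * e) + 4 * B by lra.
  have -> : 4 / (3 * pi) * B = (4 * B / pi) / 3 by rewrite invfM; ring.
  have h2 : 3 * `|F y - G y| <= D + 3 * e + 4 * B / pi.
    rewrite -(ler_pM2l pi0) (le_trans h1)// [X in _ <= X]mulrDr lerD2l.
    by rewrite (mulrC pi) divfK ?gt_eqF.
  lra.
(* The bound is uniform in y, so it passes to the supremum. Absorbing D / 3 multiplies the rest by
   3/2: the coefficient of [B] becomes 2 / pi <= 1, and 2 dlt b M becomes 3 dlt b M. *)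
have D3 : D <= D / 3 + (4 / (3 * pi)) * B + 2 * dlt * b * M.
  by apply: ge_sup; [exists `|F 0 - G 0|, 0|move=> _ [y _ <-]].
have B0 : 0 <= B by rewrite (le_trans _ (hB 0)).
have pi2 : 2 <= pi :> R by exact: pi_ge2.
move=> y; rewrite (le_trans (hD y))//.
have : 4 / (3 * pi) * B <= 2 / 3 * B.
  by rewrite ler_wpM2r// ler_pdivrMr ?mulr_gt0//; lra.
move: D3; set e := _ * B => D3 eB.
have -> : 3 * dlt * b * M = 3 / 2 * (2 * dlt * b * M) by field.
lra.
Qed.

End smoothing.

(** * Zero-bias laws *)

Section second_moment.
Context {R : realType}.
Local Open Scope ereal_scope.
Implicit Types nu : {measure set R -> \bar R}.

(** By Chebyshev, the sets where |u| >= 1 / (n + 1) have finite measure, and the point 0 that they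
    miss is null. This allows exchanging integrals against [nu]. *)
Lemma second_moment_sigma_finite nu :
  nu [set 0%R] = 0 -> levy_second_moment nu < +oo -> sigma_finite setT nu.
Proof.
move=> nu0 nu2.
pose A n : set R := [set u | (n.+1%:R^-1 <= `|u|)%R].
have mA n : measurable (A n).
  rewrite /A -[X in measurable X]setTI.
  apply: (@measurable_fun_le _ _ _ setT (cst (n.+1%:R^-1)%R) (fun u : R => `|u|%R)) => //.
exists (fun n => [set 0%R] `|` A n).
  apply/seteqP; split => // u _; have [->|u0] := eqVneq u 0%R.
    by exists 0%N => //; left.
  have [n _ un] : exists2 n, True & (`|u|^-1 <= n.+1%:R)%R.
    exists (Num.truncn `|u|^-1) => //.
    by rewrite ltW// truncnS_gt.
  exists n => //; right; rewrite /A/= invf_ple ?posrE ?normr_gt0//.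
move=> n; split; first exact: measurableU.
apply: (@le_lt_trans _ _ (nu [set 0%R] + nu (A n))); first exact: measureU2.
rewrite nu0 add0e.
have e0 : (0 < n.+1%:R^-1 ^+ 2 :> R)%R by rewrite exprn_gt0// invr_gt0.
rewrite -(@lte_pmul2l _ (n.+1%:R^-1 ^+ 2)%:E)//.
rewrite gt0_muley ?lte_fin// -integral_cst//.
apply: le_lt_trans nu2; apply: (@le_trans _ _ (\int[nu]_(u in A n) (u ^+ 2)%:E)).
  apply: ge0_le_integral => //.
  - by move=> u _; rewrite lee_fin ltW.
  - by apply/measurable_EFinP; apply: measurable_funTS; exact: measurable_funX.
  - move=> u; rewrite /A /= => nu_; rewrite lee_fin -(real_normK (num_real u)).
    by rewrite lerXn2r// nnegrE.
apply: ge0_subset_integral => //.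
  by apply/measurable_EFinP; exact: measurable_funX.
by move=> u _; rewrite lee_fin sqr_ge0.
Qed.

Lemma second_moment_ge0 nu : 0 <= levy_second_moment nu.
Proof. by apply: integral_ge0 => u _; rewrite lee_fin sqr_ge0. Qed.

Lemma levy_tail_ge0 nu v : 0 <= levy_tail nu v.
Proof.
rewrite /levy_tail; case: ifPn => v0; last case: ifPn => // v0'.
  apply: integral_ge0 => u /=; rewrite in_itv/= andbT lee_fin.
  by apply: le_trans; exact: ltW.
by apply: integral_ge0 => u /=; rewrite in_itv/= lee_fin oppr_ge0 => /le_trans; apply; exact: ltW.
Qed.

(** Where |u| >= |v|, one has |u| <= u^2 / |v|. *)
Lemma levy_tail_le nu v : v != 0%R ->
  levy_tail nu v <= (`|v|^-1)%:E * levy_second_moment nu.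
Proof.
move=> v0; rewrite -ge0_integralZl//; last 2 first.
- by apply/measurable_EFinP; exact: measurable_funX.
- by move=> u _; rewrite lee_fin sqr_ge0.
have main (D : set R) (f : R -> R) : measurable D -> measurable_fun setT f ->
    (forall u, D u -> (0 <= f u <= `|v|^-1 * u ^+ 2)%R) ->
    \int[nu]_(u in D) (f u)%:E <= \int[nu]_u ((`|v|^-1)%:E * (u ^+ 2)%:E).
  move=> mD mf fD; apply: (@le_trans _ _ (\int[nu]_(u in D) ((`|v|^-1)%:E * (u ^+ 2)%:E))).
    apply: ge0_le_integral => //.
    - by move=> u /fD/andP[]; rewrite lee_fin.
    - by apply/measurable_EFinP; exact: measurable_funTS.
    - apply: measurable_funTS; apply/measurable_EFinP.
      by apply: measurable_funM => //; exact: measurable_funX.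
    - by move=> u /fD/andP[]; rewrite lee_fin.
  apply: ge0_subset_integral => //.
    by apply/measurable_EFinP; apply: measurable_funM => //; exact: measurable_funX.
  by move=> u _; rewrite -EFinM lee_fin mulr_ge0 ?invr_ge0 ?sqr_ge0.
rewrite /levy_tail; case: ifPn => vp; last case: ifPn => vn.
- apply: main => // u /=; rewrite in_itv/= andbT => vu.
  have u0 : (0 <= u)%R by rewrite (le_trans _ vu)// ltW.
  rewrite u0 gtr0_norm//= expr2 mulrA -[leLHS]mul1r ler_wpM2r//.
  by rewrite mulrC ler_pdivlMr// mul1r.
- apply: main => // u /=; rewrite in_itv/= => uv.
  have u0 : (u <= 0)%R by rewrite (le_trans uv)// ltW.
  rewrite oppr_ge0 u0 ltr0_norm//= -sqrrN expr2 mulrA -[leLHS]mul1r.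
  rewrite ler_wpM2r ?oppr_ge0//.
  by rewrite mulrC ler_pdivlMr ?oppr_gt0// mul1r lerN2.
- by apply: integral_ge0 => u _; rewrite -EFinM lee_fin mulr_ge0 ?invr_ge0 ?sqr_ge0.
Qed.

Definition zero_bias_law nu (rho : probability R R) := forall A : set R, measurable A ->
  rho A = \int[lebesgue_measure]_(u in A) (levy_tail nu u / levy_second_moment nu).

(** In both excluded cases the density would vanish identically, against total mass 1: a zero second
    moment kills the tail, and the inverse of an infinite one is 0. *)
Lemma zero_bias_law_second_moment nu (rho : probability R R) :
  zero_bias_law nu rho -> 0 < levy_second_moment nu < +oo.
Proof.
move=> rhoE.
have rho1 : \int[lebesgue_measure]_u (levy_tail nu u / levy_second_moment nu) = 1.
  by rewrite -rhoE// probability_setT.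
rewrite lt0e second_moment_ge0 andbT; apply/andP; split.
  apply/negP => /eqP nu0; move: rho1.
  rewrite integral0_eq; first by move=> /esym/eqP; rewrite onee_eq0.
  move=> u _; suff -> : levy_tail nu u = 0 by rewrite mul0e.
  have [->|u0] := eqVneq u 0%R; first by rewrite /levy_tail ltxx.
  by apply/eqP; rewrite eq_le levy_tail_ge0 (le_trans (levy_tail_le _ u0))// nu0 mule0.
rewrite ltey; apply/negP => /eqP nuy; move: rho1.
rewrite integral0_eq; first by move=> /esym/eqP; rewrite onee_eq0.
by move=> u _; rewrite nuy invey mule0.
Qed.

End second_moment.

Section zero_bias.
Context {R : realType}.
Variables (nu : {sigma_finite_measure set R -> \bar R}) (rho : probability R R).
Notation leb := (@lebesgue_measure R).
Hypothesis rhoE : zero_bias_law nu rho.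

Let eta : R := fine (levy_second_moment nu).

Let etaE : levy_second_moment nu = eta%:E.
Proof.
have /andP[e0 ey] := zero_bias_law_second_moment rhoE.
by rewrite /eta fineK// ge0_fin_numE// ltW.
Qed.

Let eta_gt0 : 0 < eta.
Proof.
by have /andP[] := zero_bias_law_second_moment rhoE; rewrite etaE lte_fin.
Qed.

Let tail v : R := fine (levy_tail nu v).

Let tailE v : levy_tail nu v = (tail v)%:E.
Proof.
rewrite /tail fineK// ge0_fin_numE ?levy_tail_ge0//.
have [->|v0] := eqVneq v 0; first by rewrite /levy_tail ltxx ltry.
by rewrite (le_lt_trans (levy_tail_le _ v0))// etaE -EFinM ltry.
Qed.

(** The indicator that v lies between 0, excluded, and u, included, on either side of 0; expressed
    through v and u - v for joint measurability. *)
Let between (u v : R) : R :=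
  \1_(`]0, +oo[) v * \1_(`[0, +oo[) (u - v) + \1_(`]-oo, 0[) v * \1_(`]-oo, 0]) (u - v).

(** Integrated over u against [nu] it gives q times the Lévy tail; integrated over v it gives u (Q u
    - Q 0), for an antiderivative Q of q. *)
Let kernel (q : R -> R) (uv : R * R) : \bar R :=
  (`|uv.1| * (q uv.2 * between uv.1 uv.2))%:E.

Let betweenE u v : between u v = ((0 < v) && (v <= u))%:R + ((v < 0) && (u <= v))%:R.
Proof.
by rewrite /between !indicE !mem_setE !in_itv/= !andbT -!natrM !mulnb subr_ge0 subr_le0.
Qed.

Let kernel_ge0 (q : R -> R) uv : (forall v, 0 <= q v) -> (0 <= kernel q uv)%E.
Proof. by move=> q0; rewrite lee_fin mulr_ge0// mulr_ge0// betweenE addr_ge0. Qed.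

Let measurable_kernel q : measurable_fun setT q ->
  measurable_fun [set: R * measurableTypeR R] (kernel q).
Proof.
move=> mq; apply/measurable_EFinP.
have m1 : measurable_fun [set: R * measurableTypeR R] (fun uv => uv.1 : R).
  exact: measurable_fst.
have m2 : measurable_fun [set: R * measurableTypeR R] (fun uv => uv.2 : R).
  exact: measurable_snd.
have m12 : measurable_fun [set: R * measurableTypeR R] (fun uv => uv.1 - uv.2 : R).
  exact: measurable_funB.
apply: measurable_funM; first exact: measurableT_comp.
apply: measurable_funM; first exact: (measurableT_comp mq).
by apply: measurable_funD; apply: measurable_funM; exact: measurableT_comp.
Qed.

Let kernel_tail (q : R -> R) v : (forall v, 0 <= q v) ->
  (\int[nu]_u kernel q (u, v) = (q v)%:E * levy_tail nu v)%E.
Proof.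
move=> q0; rewrite /levy_tail /kernel /=; have [v0|v0|v0] := ltgtP 0 v.
- rewrite -ge0_integralZl//; last 2 first.
  + by move=> u /=; rewrite in_itv/= andbT lee_fin; apply: le_trans; exact: ltW.
  + by rewrite lee_fin.
  rewrite [RHS]integral_mkcond; apply: eq_integral => u _.
  rewrite patchE betweenE v0 ltNge (ltW v0) /= addr0 mem_setE in_itv/= andbT.
  case: ifPn => vu; last by rewrite !mulr0.
  by rewrite mulr1 mulrC EFinM ger0_norm// (le_trans _ vu)// ltW.
- rewrite -ge0_integralZl//; last 3 first.
  + by apply/measurable_EFinP; exact: measurable_funTS.
  + by move=> u /=; rewrite in_itv/= lee_fin oppr_ge0 => /le_trans; apply; exact: ltW.
  + by rewrite lee_fin.
  rewrite [RHS]integral_mkcond; apply: eq_integral => u _.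
  rewrite patchE betweenE v0 ltNge (ltW v0) /= add0r mem_setE in_itv/=.
  case: ifPn => vu; last by rewrite !mulr0.
  by rewrite mulr1 mulrC EFinM ler0_norm// (le_trans vu)// ltW.
- rewrite mule0 integral0_eq// => u _.
  by rewrite betweenE -v0 ltxx/= addr0 !mulr0.
Qed.

Let kernel_antiderivative (q Q : R -> R) (u : R) : (forall v : R, is_derive v (1 : R) Q (q v)) ->
  continuous q -> (forall v, 0 <= q v) ->
  (\int[leb]_v kernel q (u, v) = (u * (Q u - Q 0))%:E)%E.
Proof.
move=> dQ cq q0; have mq := continuous_measurable_fun cq.
have FTC a b : a < b -> (\int[leb]_(v in `[a, b]) (q v)%:E = (Q b - Q a)%:E)%E.
  move=> ab; have cQ : continuous Q.
    by move=> v; apply: differentiable_continuous; exact/derivable1_diffP/ex_derive.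
  rewrite (@continuous_FTC2 _ q Q)//.
  - exact: continuous_subspaceT.
  - split; [by move=> v _; exact: ex_derive
      |apply: cvg_at_right_filter; exact: cQ
      |apply: cvg_at_left_filter; exact: cQ].
  - by move=> v _; rewrite derive1E; exact: derive_val.
have cut (D : set R) : measurable D -> (forall v, between u v = \1_D v) ->
    (\int[leb]_v kernel q (u, v) = `|u|%:E * \int[leb]_(v in D) (q v)%:E)%E.
  move=> mD bD; rewrite -ge0_integralZl//; last 2 first.
  - by apply/measurable_EFinP; exact: measurable_funTS.
  - by move=> v _; rewrite lee_fin.
  rewrite [RHS]integral_mkcond; apply: eq_integral => v _.
  rewrite patchE /kernel /= bD indicE; case: ifPn => _.
    by rewrite mulr1 EFinM.
  by rewrite !mulr0.
have [u0|u0|<-] := ltgtP 0 u.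
- rewrite (cut `]0, u]%classic)//; last first.
    move=> v; rewrite betweenE indicE mem_setE in_itv/=.
    by case: (ltgtP v 0) => [v0|v0|->] /=; rewrite ?addr0 ?ltxx//
      ?add0r ?leNgt ?(lt_trans v0).
  rewrite integral_itv_obnd_cbnd; last exact/measurable_EFinP/measurable_funTS.
  by rewrite FTC// gtr0_norm.
- rewrite (cut `[u, 0[%classic)//; last first.
    move=> v; rewrite betweenE indicE mem_setE in_itv/=.
    case: (ltgtP v 0) => [v0|v0|->] /=.
    - by rewrite add0r andbT.
    - by rewrite andbF addr0 leNgt (lt_trans u0 v0).
    - by rewrite andbF addr0.
  rewrite integral_itv_bndo_bndc; last exact/measurable_EFinP/measurable_funTS.
  by rewrite FTC// ltr0_norm// -EFinM mulNr -mulrN opprB.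
- rewrite mul0r integral0_eq// => v _.
  by rewrite /kernel/= normr0 mul0r.
Qed.

(** The tail is the inner integral of the kernel with q = 1, so Tonelli provides its
    measurability. *)
Let measurable_tail : measurable_fun setT tail.
Proof.
apply/measurable_EFinP.
have -> : EFin \o tail = fun v => (\int[nu]_u kernel (fun=> 1%R) (u, v))%E.
  by apply/funext => v; rewrite /= -tailE kernel_tail// mul1e.
apply: (@measurable_fun_fubini_tonelli_G _ _ R (measurableTypeR R) R nu
  (kernel (fun=> 1%R))).
  exact: measurable_kernel.
by move=> uv; exact: kernel_ge0.
Qed.


Let integral_rho (q : R -> R) : measurable_fun setT q -> (forall v, 0 <= q v) ->
  (\int[rho]_v (q v)%:E = \int[leb]_v ((q v)%:E * (tail v / eta)%:E))%E.
Proof.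
move=> mq q0.
(* [rho] and [leb] live on two presentations of the Borel line; the push-forward along the identity
   carries [rho] to that of [leb]. *)
pose idR : R -> measurableTypeR R := id.
have mid : measurable_fun setT idR by move=> _ Y mY; rewrite setTI; exact: mY.
transitivity (\int[pushforward rho idR]_v (q v)%:E)%E.
  rewrite ge0_integral_pushforward//; first exact/measurable_EFinP.
  by move=> v _; rewrite lee_fin.
apply: (@integral_with_density _ _ R leb _ (fun v => tail v / eta)).
- suff: measurable_fun setT (fun v : R => tail v / eta) by [].
  exact: measurable_funM.
- by move=> v; rewrite divr_ge0 ?(ltW eta_gt0)// -lee_fin -tailE levy_tail_ge0.
- move=> A mA; transitivity (rho A); first by [].
  rewrite rhoE//.
  apply: eq_integral => v _; rewrite tailE etaE inver gt_eqF//.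
- exact/measurable_EFinP.
- by move=> v; rewrite lee_fin.
Qed.

(** The characteristic property of the zero-bias law, by Tonelli for [kernel]: the two orders of
    integration give the two sides. Tonelli is the reason for taking [q] nonnegative. *)
Lemma zero_bias_identity (q Q : R -> R) : (forall v : R, is_derive v (1 : R) Q (q v)) ->
  continuous q -> (forall v, 0 <= q v) -> rho.-integrable setT (EFin \o q) ->
  \int[nu]_u (u * (Q u - Q 0)) = fine (levy_second_moment nu) * \int[rho]_v q v.
Proof.
move=> dQ cq q0 iq; have mq := continuous_measurable_fun cq.
rewrite -/eta -[RHS]/(fine (eta%:E) * _) /Rintegral -fineM//; last first.
  exact: integrable_fin_num iq.
congr fine; rewrite integral_rho//.
transitivity (\int[nu]_u \int[leb]_v kernel q (u, v))%E.
  by apply: eq_integral => u _; rewrite (kernel_antiderivative _ dQ).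
rewrite (@fubini_tonelli _ _ R (measurableTypeR R) R nu leb (kernel q)); last 2 first.
- exact: measurable_kernel.
- by move=> uv; exact: kernel_ge0.
rewrite -ge0_integralZl//; last 3 first.
- apply/measurable_EFinP; apply: measurable_funM => //.
  exact: measurable_funM.
- move=> v _; rewrite -EFinM lee_fin mulr_ge0// divr_ge0 ?(ltW eta_gt0)//.
  by rewrite -lee_fin -tailE levy_tail_ge0.
- by rewrite lee_fin ltW.
apply: eq_integral => v _; rewrite kernel_tail// tailE -!EFinM mulrCA.
by rewrite [eta * _]mulrC divfK// gt_eqF.
Qed.

Let dominated_by_sqr (f : R -> R) (k : R) : measurable_fun setT f ->
  (forall u, `|f u| <= k * u ^+ 2) -> nu.-integrable setT (EFin \o f).
Proof.
move=> mf fk; apply: (@integrable_dominated _ _ R nu f (fun u => k * u ^+ 2)) => //.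
under [_ \o _]funext do rewrite /= EFinM.
apply: integrableZl => //; apply/integrableP; split.
  by apply/measurable_EFinP; exact: measurable_funX.
under eq_integral do rewrite gee0_abs ?lee_fin ?sqr_ge0//.
by have /andP[] := zero_bias_law_second_moment rhoE.
Qed.

Let integrable_sqr : nu.-integrable setT (EFin \o (fun u => u ^+ 2)).
Proof.
apply: (@dominated_by_sqr _ 1); first exact: measurable_funX.
by move=> u; rewrite mul1r ger0_norm ?sqr_ge0.
Qed.

Lemma zero_bias_sin s : 0 <= s ->
  \int[nu]_u (u * sin (s * u)) = eta * (s * cos_transform rho s).
Proof.
move=> s0.
(* The linear term of [Q] makes its derivative nonnegative; it contributes [s * eta] to both sides
   of the identity and cancels. *)
pose q v : R := s * (1 + cos (s * v)); pose Q v : R := s * v + sin (s * v).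
have mc := measurable_cosMl s; have ms := measurable_sinMl s.
have := @zero_bias_identity q Q.
have -> : \int[nu]_u (u * (Q u - Q 0)) = s * eta + \int[nu]_u (u * sin (s * u)).
  rewrite /Q mulr0 sin0 addr0.
  under eq_Rintegral do rewrite subr0 mulrDr mulrCA -expr2.
  rewrite RintegralD//.
  - by rewrite RintegralZl.
  - apply: (@dominated_by_sqr _ s).
      by apply: measurable_funM => //; exact: measurable_funX.
    by move=> u; rewrite ger0_norm// mulr_ge0 ?sqr_ge0.
  - apply: (@dominated_by_sqr _ s); first exact: measurable_funM.
    move=> u; rewrite normrM (le_trans (ler_wpM2l _ (normr_sin_le _)))//.
    by rewrite normrM (ger0_norm s0) mulrCA -expr2 real_normK ?num_real.
have -> : \int[rho]_v q v = s * (1 + cos_transform rho s).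
  rewrite /q RintegralZl//.
    rewrite RintegralD//; last exact: integrable_cosMl.
      by rewrite Rintegral_probability_cst.
    exact: finite_measure_integrable_cst.
  apply: (@bounded_integrable_probability _ _ _ _ _ 2).
    exact: measurable_funD.
  by move=> v; have := cos_max (s * v); rewrite !ler_norml; lra.
rewrite -/eta => H; apply: (@addrI _ (s * eta)).
transitivity (eta * (s * (1 + cos_transform rho s))); [apply: H|by ring].
- move=> v; apply: is_derive_eq.
  by rewrite /q /GRing.scale /=; ring.
- by move=> v; apply: differentiable_continuous; exact/derivable1_diffP.
- by move=> v; rewrite mulr_ge0//; have := cos_geN1 (s * v); lra.
- apply: (@bounded_integrable_probability _ _ _ _ _ (s * 2)).
    by apply: measurable_funM => //; exact: measurable_funD.
  move=> v; rewrite normrM (ger0_norm s0) ler_wpM2l//.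
  by have := cos_max (s * v); rewrite !ler_norml; lra.
Qed.

Lemma zero_bias_cos s : 0 <= s ->
  \int[nu]_u (u * (1 - cos (s * u))) = eta * (s * sin_transform rho s).
Proof.
move=> s0.
(* The same linear correction, now for the antiderivative - cos(s v). *)
pose q v : R := s * (1 + sin (s * v)); pose Q v : R := s * v - cos (s * v).
have mc := measurable_cosMl s; have ms := measurable_sinMl s.
have := @zero_bias_identity q Q.
have -> : \int[nu]_u (u * (Q u - Q 0)) =
    s * eta + \int[nu]_u (u * (1 - cos (s * u))).
  rewrite /Q mulr0 cos0 sub0r.
  under eq_Rintegral do rewrite opprK addrAC -addrA mulrDr mulrCA -expr2.
  rewrite RintegralD//.
  - by rewrite RintegralZl.
  - apply: (@dominated_by_sqr _ s).
      by apply: measurable_funM => //; exact: measurable_funX.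
    by move=> u; rewrite ger0_norm// mulr_ge0 ?sqr_ge0.
  - apply: (@dominated_by_sqr _ s).
      by apply: measurable_funM => //; exact: measurable_funB.
    move=> u; rewrite normrM distrC (le_trans (ler_wpM2l _ (normr_cosB1_le _)))//.
    by rewrite normrM (ger0_norm s0) mulrCA -expr2 real_normK ?num_real.
have -> : \int[rho]_v q v = s * (1 + sin_transform rho s).
  rewrite /q RintegralZl//.
    rewrite RintegralD//; last exact: integrable_sinMl.
      by rewrite Rintegral_probability_cst.
    exact: finite_measure_integrable_cst.
  apply: (@bounded_integrable_probability _ _ _ _ _ 2).
    exact: measurable_funD.
  by move=> v; have := sin_max (s * v); rewrite !ler_norml; lra.
rewrite -/eta => H; apply: (@addrI _ (s * eta)).
transitivity (eta * (s * (1 + sin_transform rho s))); [apply: H|by ring].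
- move=> v; apply: is_derive_eq.
  by rewrite /q /GRing.scale /=; ring.
- by move=> v; apply: differentiable_continuous; exact/derivable1_diffP.
- by move=> v; rewrite mulr_ge0//; have := sin_geN1 (s * v); lra.
- apply: (@bounded_integrable_probability _ _ _ _ _ (s * 2)).
    by apply: measurable_funM => //; exact: measurable_funD.
  move=> v; rewrite normrM (ger0_norm s0) ler_wpM2l//.
  by have := sin_max (s * v); rewrite !ler_norml; lra.
Qed.

(* Integrating [d/ds G(s u)] over [s] in [0, t] and exchanging the integrals. *)
Let integral_by_derivative (G g : R -> R) t :
  (forall x : R, is_derive x (1 : R) G (g x)) -> continuous g -> G 0 = 0 ->
  (forall x, `|g x| <= `|x|) -> 0 < t ->
  leb.-integrable setT
    (fun s => (\1_(`[0, t]) s * \int[nu]_u (u * g (s * u)))%:E) /\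
  \int[nu]_u G (t * u) = \int[leb]_s (\1_(`[0, t]) s * \int[nu]_u (u * g (s * u))).
Proof.
move=> dG cg G0 gx t0; have mg := continuous_measurable_fun cg.
pose f (su : R * R) : R := \1_(`[0, t]) su.1 * (su.2 * g (su.1 * su.2)).
have is1 s : \int[nu]_u f (s, u) = \1_(`[0, t]) s * \int[nu]_u (u * g (s * u)).
  rewrite /f /= RintegralZl//; apply: (@dominated_by_sqr _ `|s|).
    apply: measurable_funM => //; apply: (measurableT_comp mg).
    exact: measurable_funM.
  move=> u; rewrite normrM (le_trans (ler_wpM2l _ (gx _)))//.
  by rewrite normrM mulrCA -expr2 real_normK ?num_real.
have [] := @Fubini_dominated _ _ _ _ R leb nu f
  (fun s => t * \1_(`[0, t]) s) (fun u => u ^+ 2).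
- have m1 : measurable_fun [set: measurableTypeR R * R] (fun su => su.1 : R).
    exact: measurable_fst.
  have m2 : measurable_fun [set: measurableTypeR R * R] (fun su => su.2 : R).
    exact: measurable_snd.
  apply: measurable_funM; first exact: measurableT_comp.
  apply: measurable_funM => //; apply: (measurableT_comp mg).
  exact: measurable_funM.
- under [_ \o _]funext do rewrite /= EFinM.
  by apply: integrableZl => //; exact: integrable_indic_itv.
- exact: integrable_sqr.
- move=> s u; rewrite /f /= indicE; case: (boolP (_ \in _)); last first.
    by rewrite mul0r mulr0 mul0r normr0.
  rewrite mem_setE in_itv/= => /andP[s0 st].
  rewrite mul1r mulr1 normrM (le_trans (ler_wpM2l _ (gx _)))//.
  rewrite normrM (ger0_norm s0) mulrCA -expr2 real_normK ?num_real//.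
  by rewrite ler_wpM2r ?sqr_ge0.
move=> ig fub; split.
  by under [fun s => _]funext do rewrite -is1.
under [RHS]eq_Rintegral do rewrite -is1.
rewrite fub; apply: eq_Rintegral => u _.
have cG : continuous G.
  by move=> x; apply: differentiable_continuous; exact/derivable1_diffP/ex_derive.
transitivity (\int[leb]_(s in `[0, t]) (u * g (s * u))).
  have cGu : continuous (fun s : R => G (s * u)).
    by move=> s; apply: continuous_comp; [exact: mulrr_continuous|exact: cG].
  have dGu s : is_derive s (1 : R) (fun s => G (s * u)) (u * g (s * u)).
    have := dG (s * u) => dGs.
    apply: is_derive_eq.
    by rewrite /GRing.scale /=; ring.
  rewrite /Rintegral (@continuous_FTC2 _ _ (fun s => G (s * u)))//.
  - by rewrite mul0r G0 sube0.
  - apply: continuous_subspaceT => s; apply: cvgMr.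
    by apply: continuous_comp; [exact: mulrr_continuous|exact: cg].
  - split; [by move=> s _; exact: ex_derive
      |apply: cvg_at_right_filter; exact: cGu
      |apply: cvg_at_left_filter; exact: cGu].
  - by move=> s _; rewrite derive1E; exact: derive_val.
rewrite Rintegral_mkcond; apply: eq_Rintegral => s _.
by rewrite /f /= patchE indicE; case: ifPn; rewrite (mul1r, mul0r).
Qed.

Let indic_eq (f g : R -> R) (t s : R) : (0 <= s -> f s = g s) ->
  \1_(`[0, t]) s * f s = \1_(`[0, t]) s * g s.
Proof.
move=> fg; rewrite indicE; case: (boolP (_ \in _)); last by rewrite !mul0r.
by rewrite mem_setE in_itv/= => /andP[/fg -> _].
Qed.

(** The [nu]-integral is minus the real part of the Lévy exponent at t. *)
Lemma levy_cos_integral t : 0 < t ->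
  leb.-integrable setT
    (fun s => (\1_(`[0, t]) s * (eta * (s * cos_transform rho s)))%:E) /\
  \int[nu]_u (1 - cos (t * u)) =
  \int[leb]_s (\1_(`[0, t]) s * (eta * (s * cos_transform rho s))).
Proof.
move=> t0; have [] := @integral_by_derivative (fun x => 1 - cos x) (@sin R) t.
- by move=> x; apply: is_derive_eq; rewrite /GRing.scale /=; ring.
- exact: continuous_sin.
- by rewrite cos0 subrr.
- exact: normr_sin_le.
- by [].
move=> + ->.
have E s : \1_(`[0, t]) s * \int[nu]_u (u * sin (s * u)) =
    \1_(`[0, t]) s * (eta * (s * cos_transform rho s)).
  apply: (@indic_eq (fun s => \int[nu]_u (u * sin (s * u)))
    (fun s => eta * (s * cos_transform rho s))).
  exact: zero_bias_sin.
by under [fun s => _]funext do rewrite E; under eq_Rintegral do rewrite E.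
Qed.

(** When the drift is the mean, the compensator is the full t u; the [nu]-integral is what is then
    subtracted from t times the mean in the imaginary part of the exponent. *)
Lemma levy_sin_integral t : 0 < t ->
  leb.-integrable setT
    (fun s => (\1_(`[0, t]) s * (eta * (s * sin_transform rho s)))%:E) /\
  \int[nu]_u (t * u - sin (t * u)) =
  \int[leb]_s (\1_(`[0, t]) s * (eta * (s * sin_transform rho s))).
Proof.
move=> t0; have [] := @integral_by_derivative (fun x => x - sin x) (fun x => 1 - cos x) t.
- by move=> x; apply: cvgB; [exact: cvg_cst|exact: continuous_cos].
- by rewrite sin0 subrr.
- by move=> x; rewrite distrC normr_cosB1_le.
- by [].
move=> + ->.
have E s : \1_(`[0, t]) s * \int[nu]_u (u * (1 - cos (s * u))) =
    \1_(`[0, t]) s * (eta * (s * sin_transform rho s)).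
  apply: (@indic_eq (fun s => \int[nu]_u (u * (1 - cos (s * u))))
    (fun s => eta * (s * sin_transform rho s))).
  exact: zero_bias_cos.
by under [fun s => _]funext do rewrite E; under eq_Rintegral do rewrite E.
Qed.

End zero_bias.

(** * Infinitely divisible laws *)

Lemma le0_of_linear_bound (R : realFieldType) (d K : R) : 0 <= K ->
  (forall t, 0 < t -> t <= 1 -> d <= t * K) -> d <= 0.
Proof.
move=> K0 dtK; rewrite leNgt; apply/negP => d0.
have dK : 0 < d + 2 * K by rewrite ltr_wpDr// mulr_ge0.
(* This t is at most 1, and d <= t K would give d + 2 K <= K. *)
have := dtK (d / (d + 2 * K)); rewrite divr_gt0//.
rewrite ler_pdivrMr// mul1r lerDl mulr_ge0// => /(_ isT isT).
by rewrite mulrAC ler_pdivlMr// ler_pM2l//; lra.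
Qed.

Section infinitely_divisible.
Context {R : realType}.
Notation leb := (@lebesgue_measure R).
Variables (mu : probability R R) (b : R) (nu : {measure set R -> \bar R}).
Variable rho : probability R R.
Hypothesis mu_ID : is_ID mu b nu.
Hypothesis rhoE : zero_bias_law nu rho.

Let eta : R := fine (levy_second_moment nu).

(** The drift plus the integral of u over the jumps with |u| > 1, that is, the mean of ID(c, 0, n)
    when the variance is finite. *)
Definition levy_mean (c : R) (n : {measure set R -> \bar R}) : R :=
  c + \int[n]_u (u - u * \1_[set v | `|v| <= 1] u).

Let nu_sigma_finite : sigma_finite setT nu.
Proof.
apply: second_moment_sigma_finite; first by have [[]] := mu_ID.
by have /andP[] := zero_bias_law_second_moment rhoE.
Qed.

(** A copy of [nu] that can carry the sigma-finite structure just established. *)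
Let nus : set R -> \bar R := nu.

HB.instance Definition _ := Measure.on nus.
HB.instance Definition _ := Measure_isSigmaFinite.Build _ _ _ nus nu_sigma_finite.

Lemma cos_exponent_integral t : 0 < t ->
  leb.-integrable setT
    (fun s => (\1_(`[0, t]) s * (eta * (s * cos_transform rho s)))%:E) /\
  \int[nu]_u (1 - cos (t * u)) =
  \int[leb]_s (\1_(`[0, t]) s * (eta * (s * cos_transform rho s))).
Proof. exact: (@levy_cos_integral R nus rho rhoE). Qed.

Lemma sin_exponent_integral t : 0 < t ->
  leb.-integrable setT
    (fun s => (\1_(`[0, t]) s * (eta * (s * sin_transform rho s)))%:E) /\
  \int[nu]_u (t * u - sin (t * u)) =
  \int[leb]_s (\1_(`[0, t]) s * (eta * (s * sin_transform rho s))).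
Proof. exact: (@levy_sin_integral R nus rho rhoE). Qed.

Let integrable_sqr : nu.-integrable setT (EFin \o (fun u => u ^+ 2)).
Proof.
apply/integrableP; split; first by apply/measurable_EFinP; exact: measurable_funX.
under eq_integral do rewrite gee0_abs ?lee_fin ?sqr_ge0//.
by have /andP[] := zero_bias_law_second_moment rhoE.
Qed.

Let dominated_by_sqr (f : R -> R) (k : R) : measurable_fun setT f ->
  (forall u, `|f u| <= k * u ^+ 2) ->
  nu.-integrable setT (EFin \o f) /\ `|\int[nu]_u f u| <= k * eta.
Proof.
move=> mf fk.
have ik : nu.-integrable setT (EFin \o (fun u => k * u ^+ 2)).
  by under [_ \o _]funext do rewrite /= EFinM; exact: integrableZl.
have iF := @integrable_dominated _ _ R nu f _ mf ik fk.
split => //; rewrite (le_trans (le_normr_Rintegral _ iF))//.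
rewrite [eta]/(\int[nu]_u (u ^+ 2)) -RintegralZl//.
by apply: le_Rintegral => //; exact: (integrable_norm iF).
Qed.

Let measurable_small : measurable [set v : R | `|v| <= 1].
Proof.
rewrite -[X in measurable X]setTI.
by apply: (@measurable_fun_le _ _ _ setT (fun v : R => `|v|) (cst (1 : R))).
Qed.

Let integrable_1Bcos t :
  nu.-integrable setT (EFin \o (fun u => 1 - cos (t * u))) /\
  `|\int[nu]_u (1 - cos (t * u))| <= t ^+ 2 * eta.
Proof.
apply: dominated_by_sqr; first by apply: measurable_funB => //; exact: measurable_cosMl.
by move=> u; rewrite distrC -exprMn normr_cosB1_le_sqr.
Qed.

Let integrable_Bsin t :
  nu.-integrable setT (EFin \o (fun u => t * u - sin (t * u))) /\
  `|\int[nu]_u (t * u - sin (t * u))| <= t ^+ 2 * eta.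
Proof.
apply: dominated_by_sqr.
  by apply: measurable_funB; [exact: measurable_funM|exact: measurable_sinMl].
by move=> u; rewrite distrC -exprMn normr_sinB_le_sqr.
Qed.

Let integrable_large :
  nu.-integrable setT (EFin \o (fun u => u - u * \1_[set v | `|v| <= 1] u)).
Proof.
apply: (proj1 (@dominated_by_sqr _ 1 _ _)).
  by apply: measurable_funB => //; apply: measurable_funM.
move=> u; rewrite mul1r indicE; case: (boolP (_ \in _)).
  by rewrite mulr1 subrr normr0 sqr_ge0.
rewrite notin_setE/= => /negP; rewrite -ltNge => u1.
by rewrite mulr0 subr0 -(real_normK (num_real u)) expr2 ler_peMl// ltW.
Qed.

(** The truncated compensator is replaced by the full one, and the integral over the large jumps
    moves into the mean; both integrals exist because the second moment is finite. *)
Lemma levy_exponentE t :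
  cos_transform mu t = expR (- \int[nu]_u (1 - cos (t * u))) *
    cos (t * levy_mean b nu - \int[nu]_u (t * u - sin (t * u))) /\
  sin_transform mu t = expR (- \int[nu]_u (1 - cos (t * u))) *
    sin (t * levy_mean b nu - \int[nu]_u (t * u - sin (t * u))).
Proof.
have := mu_ID.2 t; rewrite /charfun /levy_exponent /cintegral /cexp /=.
have -> : \int[nu]_u (expR 0 * cos (t * u) - 1 - 0) = - \int[nu]_u (1 - cos (t * u)).
  rewrite -[RHS]mulN1r -RintegralZl//; last exact: (integrable_1Bcos t).1.
  by apply: eq_Rintegral => u _; rewrite expR0 mul1r subr0 mulN1r opprB.
have -> : \int[nu]_u (expR 0 * sin (t * u) - 0 - t * u * \1_[set v | `|v| <= 1] u) =
    t * \int[nu]_u (u - u * \1_[set v | `|v| <= 1] u) -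
    \int[nu]_u (t * u - sin (t * u)).
  rewrite -(RintegralZl _ measurableT integrable_large).
  rewrite -RintegralB//.
  - by apply: eq_Rintegral => u _; rewrite expR0 mul1r; ring.
  - under [_ \o _]funext do rewrite /= EFinM.
    by apply: integrableZl => //; exact: integrable_large.
  - exact: (integrable_Bsin t).1.
rewrite addrA -mulrDr add0r => -[c s]; split.
  by rewrite -c; apply: eq_Rintegral => u _; rewrite expR0 mul1r.
by rewrite -s; apply: eq_Rintegral => u _; rewrite expR0 mul1r.
Qed.

(* Both sides are the derivative at 0 of the imaginary part of the
   characteristic function. *)
Lemma mean_infinitely_divisible :
  mu.-integrable setT (EFin \o (fun x => x ^+ 2)) ->
  mu.-integrable setT (EFin \o (fun x => x)) ->
  \int[mu]_x x = levy_mean b nu.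
Proof.
move=> i2 i1; set m := \int[mu]_x x; set m' := levy_mean b nu.
set V := \int[mu]_x x ^+ 2.
have V0 : 0 <= V by apply: Rintegral_ge0 => x _; exact: sqr_ge0.
have eta0 : 0 <= eta by rewrite fine_ge0// second_moment_ge0.
(* The coefficients of t^2 in four errors: [V] from linearising the sine under [mu], then [eta] from
   e^{-A} - 1, the square from sin y - y, and [eta] from [B]. *)
pose K := V + eta + (`|m'| + eta) ^+ 2 + eta.
have K0 : 0 <= K by rewrite !addr_ge0 ?sqr_ge0.
have small t : 0 < t -> t <= 1 -> `|m - m'| <= t * K.
  move=> t0 t1; have [_ sE] := levy_exponentE t.
  have [_] := integrable_1Bcos t; have [_] := integrable_Bsin t.
  move: sE; set A := \int[nu]_u (1 - cos _); set B := \int[nu]_u (_ - sin _).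
  move=> sE hB hA.
  have A0 : 0 <= A by apply: Rintegral_ge0 => u _; rewrite subr_ge0 cos_le1.
  have hm : `|sin_transform mu t - t * m| <= t ^+ 2 * V.
    have itx : mu.-integrable setT (EFin \o (fun x => t * x)).
      by under [_ \o _]funext do rewrite /= EFinM; exact: integrableZl.
    have isx : mu.-integrable setT (EFin \o (fun x => sin (t * x) - t * x)).
      under [_ \o _]funext do rewrite /= EFinB.
      by apply: integrableB => //; exact: integrable_sinMl.
    rewrite /m -RintegralZl// /sin_transform -RintegralB//; last first.
      exact: integrable_sinMl.
    rewrite (le_trans (le_normr_Rintegral _ isx))// /V -RintegralZl//.
    apply: le_Rintegral => //; first exact: (integrable_norm isx).
      by under [_ \o _]funext do rewrite /= EFinM; exact: integrableZl.
    by move=> x _; rewrite -exprMn normr_sinB_le_sqr.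
  set y := t * m' - B in sE.
  have hy : `|y| <= t * (`|m'| + eta).
    rewrite (le_trans (ler_normB _ _))// normrM gtr0_norm// mulrDr lerD2l.
    by rewrite (le_trans hB)// ler_wpM2r// expr2 ler_piMl// ltW.
  have hs : `|sin_transform mu t - t * m'| <= A + y ^+ 2 + `|B|.
    rewrite sE (_ : _ - _ = (expR (- A) - 1) * sin y + (sin y - y) - B); last first.
      by rewrite /y; ring.
    rewrite (le_trans (ler_normB _ _))// lerD2r (le_trans (ler_normD _ _))//.
    rewrite lerD ?normr_sinB_le_sqr// normrM -[leRHS]mulr1 ler_pM ?sin_max//.
    rewrite -[X in _ - X](expR0 R) (le_trans (expR_lipschitz_le0 _ _))// ?oppr_le0//.
    by rewrite subr0 normrN ger0_norm.
  have hy2 : y ^+ 2 <= t ^+ 2 * (`|m'| + eta) ^+ 2.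
    have tm0 : 0 <= t * (`|m'| + eta) by rewrite mulr_ge0 ?addr_ge0// ltW.
    by rewrite -exprMn -(real_normK (num_real y)) ler_sqr ?nnegrE.
  rewrite -(ler_pM2l t0) mulrA -expr2 /K !mulrDr.
  have -> : t * `|m - m'| = `|(sin_transform mu t - t * m') - (sin_transform mu t - t * m)|.
    by rewrite -[in LHS](gtr0_norm t0) -normrM; congr `|_|; ring.
  rewrite (le_trans (ler_normB _ _))//.
  rewrite (ger0_norm A0) in hA.
  lra.
apply/eqP; rewrite -subr_eq0 -normr_eq0 eq_le normr_ge0 andbT.
exact: le0_of_linear_bound K0 small.
Qed.

End infinitely_divisible.

(** * Comparison of two characteristic functions *)

Section transforms_comparison.
Context {R : realType}.
Notation leb := (@lebesgue_measure R).

(** Since e f - e' f' = (e - e') f + e' (f - f'), the bracket is at most D + e' t D on [0, t]; the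
    weight s and the length of the interval give t^2. Of the two moments only e', that of the limit,
    remains. *)
Lemma exponent_integral_diff (e e' D t : R) (f f' : R -> R) :
  0 < t -> 0 <= e' -> `|e - e'| <= D -> (forall s, `|f s| <= 1) ->
  (forall s, 0 <= s -> `|f s - f' s| <= s * D) ->
  leb.-integrable setT (fun s => (\1_(`[0, t]) s * (e * (s * f s)))%:E) ->
  leb.-integrable setT (fun s => (\1_(`[0, t]) s * (e' * (s * f' s)))%:E) ->
  `|\int[leb]_s (\1_(`[0, t]) s * (e * (s * f s))) -
    \int[leb]_s (\1_(`[0, t]) s * (e' * (s * f' s)))| <=
  t ^+ 2 * (D + e' * (t * D)).
Proof.
move=> t0 e'0 eD f1 ff i1 i2.
have iB : leb.-integrable setT (EFin \o (fun s =>
    \1_(`[0, t]) s * (e * (s * f s)) - \1_(`[0, t]) s * (e' * (s * f' s)))).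
  under [_ \o _]funext do rewrite /= EFinB.
  exact: integrableB.
have i1t : leb.-integrable setT (EFin \o (\1_(`[0, t]) : R -> R)).
  exact: integrable_indic_itv.
rewrite -RintegralB// (le_trans (le_normr_Rintegral _ iB))//.
have -> : t ^+ 2 * (D + e' * (t * D)) =
    \int[leb]_s (t * (D + e' * (t * D)) * \1_(`[0, t]) s).
  have lt0t : leb `[0, t]%classic = t%:E.
    by rewrite lebesgue_measure_itv/= lte_fin t0 sube0.
  have -> : \int[leb]_s (t * (D + e' * (t * D)) * \1_(`[0, t]) s) =
      t * (D + e' * (t * D)) * t.
    rewrite RintegralZl//; congr (_ * _).
    by rewrite /Rintegral integral_indic//= setIT; exact: (congr1 fine lt0t).
  by ring.
have D0 : 0 <= D by rewrite (le_trans _ eD).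
apply: le_Rintegral => //; first exact: (integrable_norm iB).
  by under [_ \o _]funext do rewrite /= EFinM; exact: integrableZl.
suff main (s : R) : `|\1_(`[0, t]) s * (e * (s * f s)) - \1_(`[0, t]) s * (e' * (s * f' s))|
    <= t * (D + e' * (t * D)) * \1_(`[0, t]) s by move=> s _; exact: main.
rewrite indicE; case: (boolP (_ \in _)); last by rewrite !mul0r subrr normr0 mulr0.
rewrite mem_setE in_itv/= => /andP[s0 st]; rewrite !mul1r mulr1.
rewrite (_ : _ - _ = s * ((e - e') * f s + e' * (f s - f' s))); last by ring.
rewrite normrM ger0_norm// ler_pM// (le_trans (ler_normD _ _))// lerD//.
  by rewrite normrM -[leRHS]mulr1 ler_pM.
rewrite normrM ger0_norm// ler_wpM2l// (le_trans (ff _ s0))//.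
by rewrite ler_wpM2r.
Qed.

(** Here x is the difference of the real parts of the exponents and w that of the imaginary parts,
    which is split into the contribution z of the means and y of the sine integrals. *)
Let exponent_arith (D e t x y z w : R) : 0 <= D -> 0 <= e -> 0 <= t ->
  x <= t ^+ 2 * (D + e * (t * D)) -> y <= t ^+ 2 * (D + e * (t * D)) ->
  z <= t * D -> w <= z + y ->
  2 * (x + w) <= 4 * (1 + e) * D * (t + t ^+ 2 + t ^+ 3).
Proof.
move=> D0 e0 t0.
have h1 : 0 <= e * (D * t) by rewrite !mulr_ge0.
have h2 : 0 <= e * (D * t ^+ 2) by rewrite !mulr_ge0 ?exprn_ge0.
have h3 : 0 <= D * t by rewrite mulr_ge0.
have h4 : 0 <= D * t ^+ 3 by rewrite mulr_ge0 ?exprn_ge0.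
lra.
Qed.

Lemma transforms_diff (mu mu' rho rho' : probability R R) (b b' D t : R)
    (nu nu' : {measure set R -> \bar R}) :
  is_ID mu b nu -> is_ID mu' b' nu' ->
  zero_bias_law nu rho -> zero_bias_law nu' rho' ->
  `|fine (levy_second_moment nu) - fine (levy_second_moment nu')| <= D ->
  `|levy_mean b nu - levy_mean b' nu'| <= D ->
  (forall s, 0 <= s -> `|cos_transform rho s - cos_transform rho' s| <= s * D) ->
  (forall s, 0 <= s -> `|sin_transform rho s - sin_transform rho' s| <= s * D) ->
  0 < t ->
  `|cos_transform mu t - cos_transform mu' t| +
  `|sin_transform mu t - sin_transform mu' t| <=
  4 * (1 + fine (levy_second_moment nu')) * D * (t + t ^+ 2 + t ^+ 3).
Proof.
move=> ID ID' zb zb' eD mD cD sD t0.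
have [-> ->] := levy_exponentE ID zb t; have [-> ->] := levy_exponentE ID' zb' t.
have [ic cE] := cos_exponent_integral ID zb t0.
have [ic' cE'] := cos_exponent_integral ID' zb' t0.
have [is_ sE] := sin_exponent_integral ID zb t0.
have [is' sE'] := sin_exponent_integral ID' zb' t0.
set e := fine _ in eD ic cE is_ sE *; set e' := fine _ in eD ic' cE' is' sE' *.
have e'0 : 0 <= e' by rewrite fine_ge0// second_moment_ge0.
have D0 : 0 <= D by rewrite (le_trans _ eD).
have b1 (P : probability R R) (s : R) : `|cos_transform P s| <= 1.
  rewrite (le_trans (le_normr_Rintegral _ (integrable_cosMl P s)))//.
  rewrite -[leRHS](Rintegral_probability_cst P 1).
  apply: le_Rintegral => //; first exact: (integrable_norm (integrable_cosMl P s)).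
    exact: finite_measure_integrable_cst.
  by move=> u _; exact: cos_max.
have b2 (P : probability R R) (s : R) : `|sin_transform P s| <= 1.
  rewrite (le_trans (le_normr_Rintegral _ (integrable_sinMl P s)))//.
  rewrite -[leRHS](Rintegral_probability_cst P 1).
  apply: le_Rintegral => //; first exact: (integrable_norm (integrable_sinMl P s)).
    exact: finite_measure_integrable_cst.
  by move=> u _; exact: sin_max.
have := exponent_integral_diff t0 e'0 eD (b1 rho) cD ic ic'.
have := exponent_integral_diff t0 e'0 eD (b2 rho) sD is_ is'.
rewrite -cE -cE' -sE -sE'.
have A0 (n : {measure set R -> \bar R}) : - (\int[n]_u (1 - cos (t * u))) <= 0.
  by rewrite oppr_le0; apply: Rintegral_ge0 => u _; rewrite subr_ge0 cos_le1.
have := @exp_polar_lipschitz R _ (t * levy_mean b nu - \int[nu]_u (t * u - sin (t * u)))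
  _ (t * levy_mean b' nu' - \int[nu']_u (t * u - sin (t * u))) (A0 nu) (A0 nu').
set A := Rintegral nu _ (fun u => 1 - _); set A' := Rintegral nu' _ (fun u => 1 - _).
set B := Rintegral nu _ (fun u => _ - sin _).
set B' := Rintegral nu' _ (fun u => _ - sin _).
move=> /le_trans + hB hA; apply.
have -> : - A - - A' = - (A - A') by ring.
rewrite normrN.
have -> : t * levy_mean b nu - B - (t * levy_mean b' nu' - B') =
  t * (levy_mean b nu - levy_mean b' nu') - (B - B') by ring.
have := ler_normB (t * (levy_mean b nu - levy_mean b' nu')) (B - B').
rewrite [X in _ <= X + _ -> _]normrM (gtr0_norm t0).
have : t * `|levy_mean b nu - levy_mean b' nu'| <= t * D by rewrite ler_pM2l.
move=> hz hw; exact: (exponent_arith D0 e'0 (ltW t0) hA hB hz hw).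
Qed.

End transforms_comparison.

(** * Kolmogorov distance *)

Section coupling_lemmas.
Context {R : realType}.
Variables (rho rho' : probability R R) (gam : probability (R * R)%type R).
Hypothesis rhoC : coupling rho rho' gam.

Let bounded_marginal (P : probability R R) (proj : R * R -> R) (f : R -> R) :
  measurable_fun setT proj -> (forall A, measurable A -> P A = gam (proj @^-1` A)) ->
  measurable_fun setT f -> (forall x, `|f x| <= 1) ->
  \int[P]_x f x = \int[gam]_z f (proj z).
Proof.
move=> mproj PE mf f1; congr fine.
rewrite (eq_measure_integral (pushforward gam proj)); last by move=> A mA _; exact: PE.
rewrite integral_pushforward//; first exact/measurable_EFinP.
apply: (@bounded_integrable_probability _ _ _ _ _ 1); first exact: measurableT_comp.
by move=> z; exact: f1.
Qed.

(** Both expectations are taken on the joint space, where the Lipschitz bound holds pointwise.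
    Boundedness of [f] makes each of them exist even if the marginals have no first moment. *)
Lemma coupling_lipschitz (f : R -> R) (s D : R) :
  measurable_fun setT f -> (forall x, `|f x| <= 1) -> 0 <= s ->
  (forall x y, `|f x - f y| <= s * `|x - y|) ->
  ('E_gam[fun z => `|z.1 - z.2|%R] <= D%:E)%E ->
  `|\int[rho]_x f x - \int[rho']_x f x| <= s * D.
Proof.
move=> mf f1 s0 fs gD.
have m1 : measurable_fun setT (fun z : R * R => z.1) by exact: measurable_fst.
have m2 : measurable_fun setT (fun z : R * R => z.2) by exact: measurable_snd.
rewrite (bounded_marginal m1)//; last first.
  by move=> A mA; rewrite -(rhoC mA).1; congr (gam _); apply/seteqP; split=> [z []|z].
rewrite (bounded_marginal m2)//; last first.
  by move=> A mA; rewrite -(rhoC mA).2; congr (gam _); apply/seteqP; split=> [z []|z].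
have ib (proj : R * R -> R) : measurable_fun setT proj ->
    gam.-integrable setT (EFin \o (fun z => f (proj z))).
  move=> mp; apply: (@bounded_integrable_probability _ _ _ _ _ 1) => //.
  exact: measurableT_comp.
have iB : gam.-integrable setT (EFin \o (fun z : R * R => f z.1 - f z.2)).
  under [_ \o _]funext do rewrite /= EFinB.
  by apply: integrableB => //; exact: ib.
have id : gam.-integrable setT (EFin \o (fun z : R * R => `|z.1 - z.2|)).
  apply/integrableP; split.
    by apply/measurable_EFinP/measurableT_comp => //; exact: measurable_funB.
  under eq_integral do rewrite gee0_abs ?lee_fin//.
  by rewrite (le_lt_trans _ (ltry D))//; move: gD; rewrite unlock.
rewrite -RintegralB//; [|exact: ib|exact: ib].
rewrite (le_trans (le_normr_Rintegral _ iB))//.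
apply: (@le_trans _ _ (\int[gam]_z (s * `|z.1 - z.2|))).
  apply: le_Rintegral => //; first exact: (integrable_norm iB).
  by under [_ \o _]funext do rewrite /= EFinM; exact: integrableZl.
rewrite RintegralZl// ler_wpM2l// -lee_fin fineK; last first.
  exact: (integrable_fin_num measurableT id).
by move: gD; rewrite unlock.
Qed.

End coupling_lemmas.

(** * The Kolmogorov bound at the level of laws *)

Section laws.
Context {R : realType}.
Notation leb := (@lebesgue_measure R).

Lemma bounded_density_lipschitz (mu : probability R R) : bounded_density mu ->
  exists2 M, 0 <= M & forall x y, x <= y ->
    distribution_function mu y <= distribution_function mu x + M * (y - x).
Proof.
move=> [f [mf f0 [M fM] muE]]; exists M; first exact: le_trans (f0 0) (fM 0).
move=> x y xy; rewrite /distribution_function.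
have -> : `]-oo, y]%classic = `]-oo, x]%classic `|` `]x, y]%classic :> set R.
  by rewrite -itv_bndbnd_setU ?bnd_simp.
rewrite measureU//; last first.
  apply/seteqP; split => // z [] /=; rewrite !in_itv/= => zx /andP[xz _].
  by move: (lt_le_trans xz zx); rewrite ltxx.
rewrite fineD ?fin_num_measure// lerD2l -lee_fin fineK ?fin_num_measure//.
apply: (@le_trans _ _ (\int[leb]_(z in `]x, y]) (f z)%:E)%E).
  by rewrite le_eqVlt; apply/orP; left; apply/eqP; exact: muE.
have lxy : leb `]x, y]%classic = (y - x)%:E.
  rewrite lebesgue_measure_itv/= lte_fin; case: ltP => //.
  by move=> yx; rewrite (@le_anti _ _ x y) ?xy// subrr.
apply: (@le_trans _ _ (\int[leb]_(z in `]x, y]) M%:E)%E).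
  apply: ge0_le_integral => //.
  - by move=> z _; rewrite lee_fin.
  - by apply/measurable_EFinP; apply: measurable_funTS.
  - by move=> z _; rewrite lee_fin.
by rewrite integral_cst//= lxy EFinM.
Qed.

Lemma integrable_id_of_sqr (mu : probability R R) :
  mu.-integrable setT (EFin \o (fun x => x ^+ 2)) ->
  mu.-integrable setT (EFin \o (fun x => x)).
Proof.
move=> i2; apply: (@integrable_dominated _ _ R mu _ (fun x => 1 + x ^+ 2)) => //.
  under [_ \o _]funext do rewrite /= EFinD.
  by apply: integrableD => //; exact: finite_measure_integrable_cst.
by move=> x; rewrite -(real_normK (num_real x)); have := normr_ge0 x; nra.
Qed.

(** The coefficient of D^(1/4) for dlt = D^(1/4): the first term comes from the characteristic
    functions, the second from smoothing a law with density at most [M]. *)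
Definition kolmogorov_constant (nu : {measure set R -> \bar R}) (M : R) : R :=
  4 * (1 + fine (levy_second_moment nu)) * @laplace_weight_moment R +
  3 * tan (pi * (3 / 8)) * M.

Let tan_ge0 : 0 <= tan (pi * (3 / 8)) :> R.
Proof.
have pi0 := @pi_gt0 R; rewrite /tan divr_ge0//.
  by rewrite sin_ge0_pi//; apply/andP; split; lra.
by rewrite cos_ge0_pihalf//; apply/andP; split; lra.
Qed.

Lemma kolmogorov_constant_ge0 nu M : 0 <= M -> 0 <= kolmogorov_constant nu M.
Proof.
move=> M0; rewrite addr_ge0// mulr_ge0//.
- by rewrite mulr_ge0// addr_ge0// fine_ge0// second_moment_ge0.
- exact: laplace_weight_moment_ge0.
- by rewrite mulr_ge0.
Qed.

Lemma kolmogorov_distance_le (mu mu' rho rho' : probability R R) (b b' D M y : R)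
    (nu nu' : {measure set R -> \bar R}) (gam : probability (R * R)%type R) :
  is_ID mu b nu -> is_ID mu' b' nu' ->
  zero_bias_law nu rho -> zero_bias_law nu' rho' -> coupling rho rho' gam ->
  mu.-integrable setT (EFin \o (fun x => x ^+ 2)) ->
  mu'.-integrable setT (EFin \o (fun x => x ^+ 2)) ->
  0 <= M -> (forall x y, x <= y ->
    distribution_function mu' y <= distribution_function mu' x + M * (y - x)) ->
  `|fine (levy_second_moment nu) - fine (levy_second_moment nu')| <= D ->
  `|\int[mu]_x x - \int[mu']_x x| <= D ->
  ('E_gam[fun z => `|z.1 - z.2|%R] <= D%:E)%E ->
  D <= 1 ->
  `|distribution_function mu y - distribution_function mu' y| <=
  kolmogorov_constant nu' M * D `^ 4^-1.
Proof.
move=> ID ID' zb zb' rhoC i2 i2' M0 hM eD mD gD D1.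
have D0 : 0 <= D by rewrite (le_trans _ eD).
have i1 := integrable_id_of_sqr i2; have i1' := integrable_id_of_sqr i2'.
have e'0 : 0 <= fine (levy_second_moment nu') by rewrite fine_ge0// second_moment_ge0.
rewrite (mean_infinitely_divisible ID zb i2 i1) in mD.
rewrite (mean_infinitely_divisible ID' zb' i2' i1') in mD.
have lip (f : R -> R) (s : R) : (forall x y, `|f x - f y| <= `|x - y|) -> 0 <= s ->
    forall x y, `|f (s * x) - f (s * y)| <= s * `|x - y|.
  by move=> fL s0 x z; rewrite (le_trans (fL _ _))// -mulrBr normrM ger0_norm.
have cD s : 0 <= s -> `|cos_transform rho s - cos_transform rho' s| <= s * D.
  move=> s0; apply: (coupling_lipschitz rhoC (measurable_cosMl s)) gD => //.
    by move=> x; exact: cos_max.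
  exact: lip cos_lipschitz s0.
have sD s : 0 <= s -> `|sin_transform rho s - sin_transform rho' s| <= s * D.
  move=> s0; apply: (coupling_lipschitz rhoC (measurable_sinMl s)) gD => //.
    by move=> x; exact: sin_max.
  exact: lip sin_lipschitz s0.
pose k := 4 * (1 + fine (levy_second_moment nu')) * D.
have k0 : 0 <= k by rewrite !mulr_ge0// addr_ge0.
have main dlt : 0 < dlt -> dlt <= 1 ->
    `|distribution_function mu y - distribution_function mu' y| <=
    k / dlt ^+ 3 * laplace_weight_moment + 3 * dlt * tan (pi * (3 / 8)) * M.
  move=> d0 d1; apply: kolmogorov_smoothing => // x.
  apply: atan_integral_diff => // t t0.
  exact: (transforms_diff ID ID' zb zb' eD mD cD sD t0).
(* For D = 0 the choice dlt = D^(1/4) is not positive. The bound is then linear in dlt, and dlt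
   tends to 0. *)
have [D_eq0|Dn0] := eqVneq D 0.
  rewrite D_eq0 powR0 ?invr_eq0 ?pnatr_eq0// mulr0.
  apply: (@le0_of_linear_bound _ _ (3 * tan (pi * (3 / 8)) * M)).
    by rewrite mulr_ge0// mulr_ge0.
  move=> dlt d0 d1; rewrite (le_trans (main _ d0 d1))// /k D_eq0 mulr0 !mul0r add0r.
  by rewrite !mulrA (mulrC dlt).
have {Dn0} Dp : 0 < D by rewrite lt0r Dn0.
(* As D = dlt^4, both terms of [main] become multiples of dlt. *)
set dlt := D `^ 4^-1.
have d0 : 0 < dlt by rewrite powR_gt0.
have d4 : dlt ^+ 4 = D.
  by rewrite -powR_mulrn ?powR_ge0// -powRrM mulVf ?powRr1// pnatr_eq0.
have d1 : dlt <= 1.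
  by rewrite -(@ler_pXn2r _ 4)// ?nnegrE ?(ltW d0)// d4 expr1n.
rewrite (le_trans (main _ d0 d1))// le_eqVlt; apply/orP; left; apply/eqP.
by rewrite /k /kolmogorov_constant -d4; field; rewrite gt_eqF.
Qed.

End laws.

(** * From random variables to their laws *)

Section random_variables.
Context d (T : measurableType d) (R : realType) (P : probability T R).
Variable X : {RV P >-> R}.
Hypothesis X2 : ('E_P[fun w => (`|X w| ^+ 2)%R] < +oo)%E.

Let X2E : ('E_P[fun w => (`|X w| ^+ 2)%R] = \int[P]_w (X w ^+ 2)%:E)%E.
Proof. by rewrite unlock; apply: eq_integral => w _; rewrite real_normK ?num_real. Qed.

Lemma integrable_sqr_distribution :
  (distribution P X).-integrable setT (EFin \o (fun x => x ^+ 2)).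
Proof.
have m2 : measurable_fun setT (EFin \o (fun x : R => x ^+ 2)).
  by apply/measurable_EFinP; exact: measurable_funX.
apply/integrableP; split => //.
under eq_integral do rewrite gee0_abs ?lee_fin ?sqr_ge0//.
rewrite ge0_integral_distribution//; first by rewrite -X2E.
by move=> x; rewrite lee_fin sqr_ge0.
Qed.

Lemma expectation_distribution : ('E_P[X] = (\int[distribution P X]_x x)%:E)%E.
Proof.
have i1 := integrable_id_of_sqr integrable_sqr_distribution.
have iX : P.-integrable setT (EFin \o X).
  apply/integrableP; split; first exact/measurable_EFinP.
  have /integrableP[_] := i1.
  rewrite ge0_integral_distribution//.
  by apply: measurableT_comp => //; exact/measurable_EFinP.
rewrite unlock fineK; last exact: (integrable_fin_num measurableT i1).
by rewrite integral_distribution.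
Qed.

End random_variables.

Lemma distribution_law d (T : measurableType d) (R : realType)
    (P : probability T R) (X : {RV P >-> R}) (mu : probability R R) (f : R -> \bar R) :
  has_law X mu -> (\int[mu]_x f x = \int[distribution P X]_x f x)%E.
Proof. by move=> Xmu; apply: eq_measure_integral => A mA _; exact/esym/Xmu. Qed.

Lemma finite_second_moment_integrable (R : realType) (mu : probability R R) :
  ('E_mu[fun x => (`|x| ^+ 2)%R] < +oo)%E ->
  mu.-integrable setT (EFin \o (fun x => x ^+ 2)).
Proof.
rewrite unlock => m2; apply/integrableP; split.
  by apply/measurable_EFinP; exact: measurable_funX.
move: m2; congr (_ < _)%E; apply: eq_integral => x _.
by rewrite /= (ger0_norm (sqr_ge0 x)) real_normK ?num_real.
Qed.

(* muoo is the law of X_oo. The constant C' is chosen after muoo, Coo and poo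
   only (boo and nuoo are determined by muoo), before all random variables. *)
Theorem proposition4p1 (R : realType)
  (muoo : probability R R) (boo : R) (nuoo : {measure set R -> \bar R})
  (Coo poo : R) :
  is_ID muoo boo nuoo ->
  nondegenerate_law muoo ->
  ('E_muoo[fun x => (`|x| ^+ 2)%R] < +oo)%E ->
  0 < Coo -> 1 <= poo ->
  charfun_growth muoo Coo poo ->
  bounded_density muoo ->
  exists2 C' : R, 0 < C' &
    forall (doo : measure_display) (Too : measurableType doo)
      (Poo : probability Too R) (Xoo Yoo : {RV Poo >-> R})
      (d : nat -> measure_display) (T : forall n, measurableType (d n))
      (P : forall n, probability (T n) R) (X Y : forall n, {RV (P n) >-> R})
      (b : nat -> R) (nu : nat -> {measure set R -> \bar R})
      (gam : nat -> probability (R * R)%type R),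
    has_law Xoo muoo ->
    extended_zero_bias Xoo nuoo Yoo ->
    (forall n, is_ID (distribution (P n) (X n)) (b n) (nu n)) ->
    (forall n, nondegenerate_law (distribution (P n) (X n))) ->
    (forall n, ('E_(P n)[fun w => (`|X n w| ^+ 2)%R] < +oo)%E) ->
    cvg_in_law X Xoo ->
    (forall n, extended_zero_bias (X n) (nu n) (Y n)) ->
    (forall n, coupling (distribution (P n) (Y n)) (distribution Poo Yoo) (gam n)) ->
    forall n : nat,
      (d_K (X n) Xoo
       <= C'%:E * Delta (X n) Xoo (nu n) nuoo (gam n) `^ ((poo + 3)^-1)%R)%E.
Proof.
move=> ID' _ m2 _ poo1 _ dens.
have i2' := finite_second_moment_integrable m2.
have [M M0 hM] := bounded_density_lipschitz dens.
pose K := kolmogorov_constant nuoo M.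
have K0 : 0 <= K by exact: kolmogorov_constant_ge0.
have p3 : 0 < poo + 3 by lra.
(* [K] serves for Delta <= 1; the added 1 makes the constant positive and covers Delta > 1, where
   the distance is at most 1. *)
exists (K + 1); first by rewrite ltr_wpDl.
move=> doo Too Poo Xoo Yoo d T P X Y b nu gam Xlaw [_ zb'] ID _ X2 _ zb cpl n.
have i2 := integrable_sqr_distribution (X2 n).
pose mu : probability R R := distribution (P n) (X n).
have zbn : zero_bias_law (nu n) (distribution (P n) (Y n)) := (zb n).2.
have zboo : zero_bias_law nuoo (distribution Poo Yoo) := zb'.
have etaE : levy_second_moment (nu n) = (fine (levy_second_moment (nu n)))%:E.
  have /andP[e0 ey] := zero_bias_law_second_moment zbn.
  by rewrite fineK// ge0_fin_numE// ltW.
have eta'E : levy_second_moment nuoo = (fine (levy_second_moment nuoo))%:E.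
  have /andP[e0 ey] := zero_bias_law_second_moment zboo.
  by rewrite fineK// ge0_fin_numE// ltW.
have EX' : ('E_Poo[Xoo] = (\int[muoo]_x x)%:E)%E.
  have X2' : ('E_Poo[fun w => (`|Xoo w| ^+ 2)%R] < +oo)%E.
    have /integrableP[_] := i2'.
    rewrite (distribution_law _ Xlaw) unlock ge0_integral_distribution//; last first.
      by apply/measurableT_comp => //; apply/measurable_EFinP; exact: measurable_funX.
    congr (_ < _)%E; apply: eq_integral => w _ /=.
    by rewrite ger0_norm ?sqr_ge0// real_normK ?num_real.
  by rewrite (expectation_distribution X2') /Rintegral -(distribution_law _ Xlaw).
pose a := `|fine (levy_second_moment (nu n)) - fine (levy_second_moment nuoo)| +
  `|\int[mu]_x x - \int[muoo]_x x|.
have a0 : 0 <= a by rewrite addr_ge0.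
set g : \bar R := 'E_(gam n)[fun z => `|z.1 - z.2|%R]%E.
have g0 : (0 <= g)%E.
  by rewrite /g unlock; apply: integral_ge0 => z _; rewrite lee_fin.
have DeltaE : Delta (X n) Xoo (nu n) nuoo (gam n) = (a%:E + g)%E.
  rewrite /Delta etaE eta'E (expectation_distribution (X2 n)) EX'.
  by rewrite -!EFinB !abse_EFin -EFinD.
have distE x : (`|cdf (X n) x - cdf Xoo x| =
    (`|distribution_function mu x - distribution_function muoo x|)%:E)%E.
  rewrite -abse_EFin EFinB !fineK ?fin_num_measure//.
  by rewrite /cdf (Xlaw _ (measurable_itv _)).
rewrite DeltaE; apply: ub_ereal_sup => _ [x _ <-]; rewrite distE.
have le1 : `|distribution_function mu x - distribution_function muoo x| <= 1.
  have /andP[] := distribution_function_itv01 mu x.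
  have /andP[] := distribution_function_itv01 muoo x.
  by rewrite ler_norml; lra.
(* If the coupling has infinite cost, the right-hand side is infinite, as the exponent and the
   constant are positive. *)
have [gy|gy] := eqVneq g +oo%E.
  rewrite gy addey// poweRyr ?invr_eq0 ?gt_eqF// gt0_muley ?leey// lte_fin.
  by rewrite ltr_wpDl.
pose D := a + fine g.
have gE : g = (fine g)%:E by rewrite fineK// ge0_fin_numE// ltey.
have fg0 : 0 <= fine g by rewrite fine_ge0.
have -> : (a%:E + g = D%:E)%E by rewrite gE.
rewrite poweR_EFin -EFinM lee_fin.
have [D1|D1] := leP D 1; last first.
  rewrite (le_trans le1)// -[leLHS]mulr1 ler_pM//; first lra.
  have p1 : 1 `^ (poo + 3)^-1 = 1 :> R by rewrite powR1.
  rewrite -[X in X <= _]p1 ge0_ler_powR ?nnegrE ?invr_ge0 ?(ltW p3) ?(ltW D1)//.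
  by rewrite (le_trans _ (ltW D1)).
have D0 : 0 <= D by rewrite addr_ge0.
apply: (@le_trans _ _ (K * D `^ 4^-1)).
  apply: (kolmogorov_distance_le x (ID n) ID' zbn zboo (cpl n) i2 i2' M0 hM) => //.
  - by rewrite /D /a -addrA lerDl addr_ge0.
  - by rewrite /D /a addrAC lerDr addr_ge0.
  - by rewrite -/g gE lee_fin lerDr.
(* Here D <= 1 and poo + 3 >= 4, so lowering the exponent from 1/4 to 1/(poo + 3) increases the
   power; D = 0 is separate, monotonicity in the exponent being for a positive base. *)
rewrite ler_pM ?powR_ge0//; first lra.
have [->|Dn0] := eqVneq D 0.
  by rewrite !powR0// invr_neq0// gt_eqF.
rewrite ger_powR// ?D1 ?andbT ?lt0r ?Dn0//.
by rewrite lef_pV2 ?posrE//; lra.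
Qed.
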